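(* Let $r, k \ge 2$ and $1\leq \ell \le k/2$. For all $n > 12 r^2(k-\ell)+\ell$, we have \[\hat{R}_r(P_{n}^{(k,\ell)}) \ge \frac{r}{k^2}\,R_{ \lfloor\frac{2r-2}{3}\rfloor}(P_{n}^{(k,\ell)}).\] Moreover, $\Omega_k(r^{2}n)=\hat{R}_r(P_{n}^{(k,\ell)})=O((r^2\log r) n)$, i.e. there are constants $c,C>0$ depending only on $k$ such that $c\,r^2n\le \hat{R}_r(P_{n}^{(k,\ell)})\le C\,(r^2\log r)\,n$ for all sufficiently large $r$ and $n$.
   Context: A $k$-graph is a $k$-uniform hypergraph. For hypergraphs $G,H$ and an integer $r\ge 1$, $G\to_r H$ means that every $r$-coloring of the edges of $G$ contains a monochromatic copy of $H$. For a $k$-graph $H$, $\hat R_r(H)$ is the minimum number of edges and $R_r(H)$ the minimum number of vertices of a $k$-graph $G$ with $G\to_r H$. For $1\le \ell\le k-1$ and $m\ge 1$, the $(k,\ell)$-path with $m$ edges is the $k$-graph with vertex set $\{v_1,\dots,v_{k+(m-1)(k-\ell)}\}$ and edges $\{v_{(i-1)(k-\ell)+1},\dots,v_{(i-1)(k-\ell)+k}\}$ for $i\in[m]$; $P_n^{(k,\ell)}$ denotes the $(k,\ell)$-path with $n$ vertices. *)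

(* Defs.v *)
From mathcomp Require Import all_boot.
From mathcomp Require Import boolp classical_sets.

Set Implicit Arguments.
Unset Strict Implicit.
Unset Printing Implicit Defensive.

Record kgraph (k : nat) := KGraph {
  vertex : finType;
  edges : {set {set vertex}};
  card_edge : forall e, e \in edges -> #|e| = k }.

(* Colors are natural numbers and only the colors of edges matter; hence, for
   r = 0, a graph has a coloring iff it has no edge, and ramsey 0 H = k as soon
   as H has an edge. Copies need not be induced. *)
Definition coloring k (r : nat) (G : kgraph k) (c : {set vertex G} -> nat) :=
  forall e, e \in edges G -> c e < r.

Definition mono_copy k (G H : kgraph k) (c : {set vertex G} -> nat) (i : nat) :=
  exists f : vertex H -> vertex G, injective f /\
    forall e, e \in edges H -> f @: e \in edges G /\ c (f @: e) = i.

Definition arrows k (r : nat) (G H : kgraph k) :=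
  forall c : {set vertex G} -> nat, coloring r c ->
    exists2 i, i < r & mono_copy H c i.

(* Least element of P; the default 0 for empty P is never reached in ramsey and
   size_ramsey, by Ramsey's theorem for hypergraphs. *)
Definition nat_min (P : set nat) : nat :=
  xget 0 [set n | P n /\ forall m, P m -> n <= m].

Definition size_ramsey k (r : nat) (H : kgraph k) : nat :=
  nat_min [set e | exists2 G : kgraph k, arrows r G H & #|edges G| = e].

Definition ramsey k (r : nat) (H : kgraph k) : nat :=
  nat_min [set n | exists2 G : kgraph k, arrows r G H & #|vertex G| = n].

Definition path_order (k l m : nat) : nat := k + m.-1 * (k - l).

(* Vertices and edges are numbered from 0. *)
Definition path_edge (k l m : nat) (i : 'I_m) : {set 'I_(path_order k l m)} :=
  [set v : 'I_(path_order k l m) | i * (k - l) <= v < i * (k - l) + k].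

Lemma card_path_edge k l m (i : 'I_m) : #|path_edge k l i| = k.
Proof.
case: m i => [[]//|m] i.
have lt j : j < k -> i * (k - l) + j < path_order k l m.+1.
  move=> jk; rewrite /path_order /= [k + _]addnC.
  by rewrite -addnS leq_add // leq_mul2r -ltnS ltn_ord orbT.
pose f (j : 'I_k) := Ordinal (lt j (ltn_ord j)).
have f_inj : injective f by move=> a b /(congr1 val)/addnI/val_inj.
rewrite -[RHS](card_ord k) -(card_imset _ f_inj); apply: eq_card => v.
rewrite inE; apply/andP/imsetP => [[le_v lt_v]|[j _ ->]] /=.
  have vk : v - i * (k - l) < k by rewrite ltn_subLR.
  by exists (Ordinal vk) => //; apply: val_inj; rewrite /= subnKC.
by rewrite leq_addr ltn_add2l.
Qed.

Lemma path_edgesP k l m (e : {set 'I_(path_order k l m)}) :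
  e \in [set path_edge k l i | i : 'I_m] -> #|e| = k.
Proof. by case/imsetP => i _ ->; apply: card_path_edge. Qed.

(* The (k,l)-path with m edges. *)
Definition path_graph (k l m : nat) : kgraph k :=
  KGraph (@path_edgesP k l m).

(* Main.v *)
Require Import Defs.
From mathcomp Require Import all_boot all_order all_algebra.
From mathcomp Require Import boolp zify.
From mathcomp Require classical_sets.
Set Implicit Arguments.
Unset Strict Implicit.
Unset Printing Implicit Defensive.

(* Lower bounds. If P has more than 2h edges, the edges meeting a set of h
   vertices can all get one color, since a vertex lies on at most two edges of
   P. Spend the colors one by one on the h vertices of currently largest degree
   until the remaining maximum degree D is so small that the i colors left
   suffice. The edges of the remaining k-graph form a graph of maximum degree at
   most k(D-1) under intersection. Coloring that graph properly gives the
   order r^2 n. For the first inequality one needs about a third as many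
   colors: color so that every edge meets at most two edges of its color, and
   recolor an independent transversal of a maximal packing of monochromatic
   paths of fixed length by one extra color. This leaves only paths with O(r)
   edges. The result is compared with R_s(P) <= k (s (m - 1) + 1), where m is
   the number of edges of P. To get this bound, split the vertices into l-sets
   and (k - 2l)-sets, give each pair of l-sets a color popular among its
   extensions, and find a path in a dense color class of pairs.

   Upper bound. Replacing each vertex of a graph by l vertices and adding k - 2l
   private vertices to each edge turns graph paths into (k,l)-paths. The graph
   is a random one on O(r p) vertices, p = m + 1, in which sets of 2p vertices
   span few edges. Depth-first search shows that the edges of a graph without a
   path on p vertices are covered by few sets of 2p vertices, so every color
   class without such a path is small. *)
Lemma nat_minP (P : classical_sets.set nat) n :
  P n -> P (nat_min P) /\ nat_min P <= n.
Proof.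
move=> Pn; rewrite /nat_min; case: classical_sets.xgetP => [_ -> [Px le] | H]; first by split=> //; apply: le.
have exP : exists i, `[< P i >] by exists n; apply/asboolP.
case: (ex_minnP exP) => i /asboolP Pi le; exfalso; apply: (H i).
by split=> // j Pj; apply: le; apply/asboolP.
Qed.

Lemma card_bigcup_le (I T : finType) (P : pred I) (F : I -> {set T}) :
  #|\bigcup_(i | P i) F i| <= \sum_(i | P i) #|F i|.
Proof.
elim/big_rec2: _ => [|i a A _ le]; first by rewrite cards0.
by apply: leq_trans (leq_card_setU _ _) _; rewrite leq_add2l.
Qed.

(** * Defective colorings and independent transversals *)

Section Coloring.
Variables (T : finType) (e : rel T).
Hypotheses (esym : symmetric e) (eirr : irreflexive e).

(** A coloring with the fewest monochromatic edges works: by minimality the color of [x] is a least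
    used one among its neighbors, hence has at most a [1/q] share of them. *)
Lemma defective_coloring q : 0 < q ->
  exists c : T -> nat, (forall x, c x < q) /\
    forall x, #|[set y | e x y & c y == c x]| * q <= #|[set y | e x y]|.
Proof.
case: q => // q _.
pose Phi (c : {ffun T -> 'I_q.+1}) := \sum_x \sum_(y | e x y) (c x == c y : nat).
pose n (c : {ffun T -> 'I_q.+1}) x j := #|[set y | e x y & c y == j]|.
case: (arg_minnP Phi (P := xpredT) (i0 := [ffun _ => ord0])) => // c _ cmin.
exists (fun x => nat_of_ord (c x)); split=> // x.
have sumn : \sum_j n c x j = #|[set y | e x y]|.
  rewrite -sum1_card (partition_big c xpredT) //=; apply: eq_bigr => j _.
  by rewrite /n -sum1_card; apply: eq_bigl => y; rewrite !inE.
suff le j : n c x (c x) <= n c x j.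
  rewrite -sumn.
  have -> (a : nat) : a * q.+1 = \sum_(j < q.+1) a by rewrite sum_nat_const card_ord mulnC.
  apply: leq_sum => j _; apply: leq_trans (le j); rewrite /n.
  by apply: subset_leq_card; apply/subsetP => y; rewrite !inE.
case: (eqVneq j (c x)) => [-> // | jx].
pose c' : {ffun T -> 'I_q.+1} := [ffun y => if y == x then j else c y].
pose rest := \sum_(z | z != x) \sum_(y | e z y && (y != x)) (c z == c y : nat).
have split_Phi (d : {ffun T -> 'I_q.+1}) : (forall y, y != x -> d y = c y) ->
  Phi d = (n c x (d x)).*2 + rest.
  move=> dc; rewrite /Phi (bigD1 x) //= -addnn -addnA; congr (_ + _).
    rewrite /n -sum1_card big_mkcond [RHS]big_mkcond; apply: eq_bigr => y _.
    rewrite inE; case exy: (e x y) => //=.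
    rewrite (dc y); first by rewrite eq_sym; case: eqP.
    by apply: contraTneq exy => ->; rewrite eirr.
  have -> : n c x (d x) = \sum_(z | z != x) (e z x && (d z == d x)).
    rewrite /n -sum1_card big_mkcond [RHS]big_mkcond; apply: eq_bigr => z _.
    rewrite inE esym; case: (eqVneq z x) => [-> | zx] /=; first by rewrite eirr.
    by rewrite (dc z) //; case: (e z x) => //=; case: eqP.
  rewrite -big_split; apply: eq_bigr => z zx /=.
  rewrite (bigID (pred1 x)) /=; congr (_ + _); last first.
    by apply: eq_bigr => y /andP[_ yx]; rewrite (dc z) // (dc y).
  case ezx: (e z x) => /=.
    by apply: big_pred1 => y; rewrite /= andbC; case: (eqVneq y x) => //= ->.
  by apply: big_pred0 => y; rewrite andbC; case: (eqVneq y x) => //= ->.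
have := cmin c' isT; rewrite (split_Phi c) // (split_Phi c'); last by move=> y yx; rewrite ffunE (negPf yx).
by rewrite leq_add2r leq_double ffunE eqxx.
Qed.

End Coloring.

Section Transversal.
Variables (T : finType) (e : rel T) (d g : nat).
Hypotheses (esym : symmetric e) (eirr : irreflexive e).
Hypothesis degd : forall x, #|[set y | e x y]| <= d.
Hypotheses (g_gt0 : 0 < g) (dg : 4 * d <= g).
Variable F : {set {set T}}.
Hypotheses (trF : trivIset F) (cardF : forall A : {set T}, A \in F -> #|A| = g).

Definition transversals (S : {set {set T}}) : {set {set T}} :=
  [set X : {set T} | [&& X \subset cover S, [forall B in S, #|X :&: B| == 1]
                       & [forall x in X, forall y in X, ~~ e x y]]].

Lemma transversalsP S (X : {set T}) :
  reflect [/\ {subset X <= cover S}, forall B : {set T}, B \in S -> #|X :&: B| = 1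
            & {in X &, forall x y, ~~ e x y}] (X \in transversals S).
Proof.
rewrite inE; apply: (iffP and3P) => -[XS XB Xe]; split.
- exact/subsetP.
- by move=> B BS; apply/eqP; apply: (forall_inP XB).
- by move=> x y xX yX; apply: (forall_inP (forall_inP Xe x xX)).
- exact/subsetP.
- by apply/forall_inP => B BS; apply/eqP/XB.
- by apply/forall_inP => x xX; apply/forall_inP => y yX; apply: Xe.
Qed.

Let disj A C u : A \in F -> C \in F -> u \in A -> u \in C -> A = C.
Proof.
move=> AF CF uA uC; apply/eqP; apply: contraLR uC => AC.
by have /trivIsetP/(_ A C AF CF AC)/disjointFr -> := trF.
Qed.

(** Pair each [X] with each [v] in [B]. Either [v |: X] is again independent, and the pair can be
    recovered from it, or [X] contains a neighbor [u] of [v]. *)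
Lemma card_transversals_extend (S : {set {set T}}) B : S \subset F -> B \in F -> B \notin S ->
  g * #|transversals S| <= #|transversals (B |: S)| +
    \sum_(v in B) \sum_(u | e v u) #|[set X in transversals S | u \in X]|.
Proof.
move=> SF BF BS.
have notin v X : v \in B -> X \in transversals S -> v \notin X.
  move=> vB /transversalsP[XS _ _]; apply: contra BS => /XS/bigcupP[C CS vC].
  by rewrite (disj BF _ vB vC) // (subsetP SF).
have -> : g * #|transversals S| =
    \sum_(v in B) (#|[set X in transversals S | [forall u in X, ~~ e v u]]|
                   + #|[set X in transversals S | ~~ [forall u in X, ~~ e v u]]|).
  rewrite -(cardF BF) -sum_nat_const; apply: eq_bigr => v _.
  rewrite -(cardsID [set X : {set T} | [forall u in X, ~~ e v u]]).
  by congr (_ + _); congr #|pred_of_set _|; apply/setP => X; rewrite !inE // andbC.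
rewrite big_split leq_add //=; last first.
  apply: leq_sum => v _.
  have sub : [set X in transversals S | ~~ [forall u in X, ~~ e v u]] \subset
      \bigcup_(u | e v u) [set X in transversals S | u \in X].
    apply/subsetP => X; rewrite inE => /andP[XS].
    rewrite negb_forall => /existsP[u]; rewrite negb_imply negbK => /andP[uX vu].
    by apply/bigcupP; exists u => //; rewrite inE XS.
  apply: leq_trans (subset_leq_card sub) _.
  exact: card_bigcup_le.
pose good v := [set X in transversals S | [forall u in X, ~~ e v u]].
have sum_sig : \sum_(v in B) #|good v| = #|[set p : T * {set T} | p.1 \in B & p.2 \in good p.1]|.
  rewrite -sum1_card (eq_bigl (fun p => (p.1 \in B) && (p.2 \in good p.1))); last by move=> p; rewrite inE.
  by rewrite -(pair_big_dep (mem B) (fun v X => X \in good v) (fun _ _ => 1)) /=; apply: eq_bigr => v _; rewrite sum1_card.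
rewrite sum_sig.
have domP p : p \in [set p : T * {set T} | p.1 \in B & p.2 \in good p.1] ->
    [/\ p.1 \in B, p.2 \in transversals S & forall u, u \in p.2 -> ~~ e p.1 u].
  by rewrite inE => /andP[pB]; rewrite inE => /andP[pS /forall_inP].
have f_inj : {in [set p : T * {set T} | p.1 \in B & p.2 \in good p.1] &, injective (fun p => p.1 |: p.2)}.
  move=> [v X] [v' X'] /domP[/= vB XS _] /domP[/= v'B X'S _] E.
  have nX := notin _ _ vB XS; have nX' := notin _ _ v'B X'S.
  have vv : v = v'.
    have := setU11 v X; rewrite E => /setU1P[//|].
    by rewrite (negPf (notin _ _ vB X'S)).
  by subst v'; congr (_, _); rewrite -(setU1K nX) E setU1K.
rewrite -(card_in_imset f_inj); apply: subset_leq_card.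
apply/subsetP => Z /imsetP[[v X] /domP[/= vB XS Xv] ->].
have nX := notin _ _ vB XS.
case/transversalsP: (XS) => Xc X1 Xe; apply/transversalsP; split.
- move=> u /setU1P[-> | /Xc/bigcupP[C CS uC]]; apply/bigcupP.
    by exists B => //; apply: setU11.
  by exists C => //; apply: setU1r.
- move=> C /setU1P[-> | CS]; last first.
    rewrite setIUl (_ : [set v] :&: C = set0) ?set0U ?X1 //.
    apply/setP => u; rewrite !inE; apply/negbTE/negP => /andP[/eqP-> vC].
    by move: BS; rewrite (disj BF _ vB vC) ?CS // (subsetP SF).
  rewrite setIUl (_ : X :&: B = set0) ?setU0; last first.
    apply/setP => u; rewrite !inE; apply/negbTE/negP => /andP[uX uB].
    by move: (notin _ _ uB XS); rewrite uX.
  by rewrite (setIidPl _) ?cards1 // sub1set.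
- move=> x y /setU1P[->|xX] /setU1P[->|yX]; rewrite ?eirr //; first exact: Xv.
    by rewrite esym Xv.
  exact: Xe.
Qed.

(** Deleting [u], the only element of [X] in [Q], is injective and leaves a transversal of the other
    parts. *)
Lemma card_transversals_contract (S : {set {set T}}) (Q : {set T}) u :
    S \subset F -> Q \in S -> u \in Q ->
  #|[set X in transversals S | u \in X]| <= #|transversals (S :\ Q)|.
Proof.
move=> SF QS uQ.
have f_inj : {in [set X in transversals S | u \in X] &, injective (fun X : {set T} => X :\ u)}.
  by move=> X Y; rewrite inE => /andP[_ uX]; rewrite inE => /andP[_ uY] /= E; rewrite -(setD1K uX) E setD1K.
rewrite -(card_in_imset f_inj); apply: subset_leq_card.
apply/subsetP => Z /imsetP[X]; rewrite inE => /andP[/transversalsP[Xc X1 Xe] uX] ->.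
have QX v : v \in Q -> v \in X -> v = u.
  have /eqP/cards1P[w E] := X1 _ QS.
  move=> vQ vX; have : v \in X :&: Q by rewrite inE vX.
  have : u \in X :&: Q by rewrite inE uX.
  by rewrite E !inE => /eqP-> /eqP->.
apply/transversalsP; split.
- move=> v /setD1P[vu vX]; have /bigcupP[C CS vC] := Xc v vX.
  apply/bigcupP; exists C => //; rewrite !inE CS andbT.
  by apply: contra vu => /eqP CQ; apply/eqP/QX; rewrite -?CQ.
- move=> C /setD1P[CQ CS]; rewrite -(X1 C CS); congr #|pred_of_set _|.
  apply/setP => v; rewrite !inE; case: (eqVneq v u) => //= ->.
  case: (boolP (u \in C)) => [uC|]; last by rewrite andbF.
  by case/eqP: CQ; apply: (disj (u := u)) => //; rewrite (subsetP SF).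
- by move=> x y /setD1P[_ xX] /setD1P[_ yX]; apply: Xe.
Qed.

(* Rosenfeld's counting argument: each further part multiplies the number of
   independent transversals by at least g / 2. *)
Lemma card_transversals_step (S : {set {set T}}) B : S \subset F -> B \in F -> B \notin S ->
  g * #|transversals S| <= 2 * #|transversals (B |: S)|.
Proof.
move: {2}#|S|.+1 (ltnSn #|S|) => n; elim: n S B => // n IHn S B Sn SF BF BS.
set N := #|transversals S|.
have rem v u : e v u -> g * #|[set X in transversals S | u \in X]| <= 2 * N.
  move=> _; case: (boolP (u \in cover S)) => [/bigcupP[Q QS uQ] | uS]; last first.
    rewrite (_ : [set X in _ | _] = set0) ?cards0 ?muln0 //.
    apply/setP => X; rewrite !inE; apply/negbTE; apply: contra uS.
    by case/andP=> /and3P[/subsetP XS _ _] /XS.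
  have QF : Q \in F by rewrite (subsetP SF).
  have := card_transversals_contract SF QS uQ.
  have : g * #|transversals (S :\ Q)| <= 2 * N.
    rewrite /N -{2}(setD1K QS); apply: IHn => //; last by rewrite !inE eqxx.
      by move: Sn; rewrite (cardsD1 Q) QS.
    by apply: subset_trans SF; apply: subD1set.
  by move=> le1 le2; apply: leq_trans le1; rewrite leq_mul2l le2 orbT.
have := card_transversals_extend SF BF BS; rewrite -/N.
set bad := \sum_(v in B) _.
(* So [bad] is at most half of [g * N], because [4 * d <= g]. *)
suff : g * bad <= g * (d * (2 * N)) by nia.
rewrite /bad big_distrr /= -(cardF BF) -sum_nat_const; apply: leq_sum => v _.
rewrite big_distrr /=; apply: (@leq_trans (\sum_(u | e v u) 2 * N)).
  by apply: leq_sum => u /rem; rewrite (cardF BF).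
rewrite sum_nat_const leq_mul2r; apply/orP; right.
by apply: leq_trans (degd v); rewrite cardsE.
Qed.

Lemma independent_transversal : exists2 X : {set T},
  {in X &, forall x y, ~~ e x y} & forall A, A \in F -> X :&: A != set0.
Proof.
suff H n (S : {set {set T}}) : #|S| = n -> S \subset F -> 0 < #|transversals S|.
  have /card_gt0P[X /transversalsP[_ X1 Xe]] := H _ F erefl (subxx _).
  by exists X => // A AF; rewrite -card_gt0 X1.
elim: n S => [|n IHn] S Sn SF.
  rewrite (cards0_eq Sn); apply/card_gt0P; exists set0; apply/transversalsP.
  by split=> [x|B|x y]; rewrite inE.
have /card_gt0P[B BS] : 0 < #|S| by rewrite Sn.
have SB : S :\ B \subset F by apply: subset_trans SF; apply: subD1set.
have := @card_transversals_step (S :\ B) B SB (subsetP SF _ BS).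
rewrite setD1K // !inE eqxx => /(_ isT).
have SBn : #|S :\ B| = n by move: Sn; rewrite (cardsD1 B) BS => -[].
by have := IHn _ SBn SB; nia.
Qed.
End Transversal.

Lemma path_lipschitz (T : eqType) (f : rel T) (h : T -> nat) (s : seq T) x0 i j :
  symmetric f -> (forall x y, f x y -> h x <= (h y).+1) -> sorted f s ->
  i < size s -> j < size s -> h (nth x0 s i) < h (nth x0 s j) + size s.
Proof.
move=> fsym hf /(sortedP x0) fs.
have step a n : a + n < size s ->
    h (nth x0 s a) <= h (nth x0 s (a + n)) + n /\ h (nth x0 s (a + n)) <= h (nth x0 s a) + n.
  elim: n => [|n IHn]; first by rewrite !addn0.
  rewrite addnS => an; have [] := IHn (ltnW an); have f1 := fs _ an.
  have := hf _ _ f1; rewrite fsym in f1; have := hf _ _ f1; lia.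
move=> si sj; case: (leqP i j) => [ij | /ltnW ji].
  have := step i (j - i); rewrite subnKC // => /(_ sj); lia.
have := step j (i - j); rewrite subnKC // => /(_ si); lia.
Qed.

(** * Breaking up graphs of maximum degree two *)

Section Break.
Variables (T : finType) (f : rel T) (g : nat).
Hypotheses (fsym : symmetric f) (deg2 : forall x, #|[set y | f x y]| <= 2).

(* On a path or cycle component, only the two ends of the segment s give access
   to the rest of the component. *)
Lemma depth_lipschitz (s : seq T) x y : uniq s -> sorted f s -> f x y ->
  (if x \in s then minn (index x s).+1 (size s - index x s) else 0) <=
  (if y \in s then minn (index y s).+1 (size s - index y s) else 0).+1.
Proof.
move=> us /(sortedP x) fs fxy; case: ifP => // xs.
set i := index x s; have si : i < size s by rewrite index_mem.
case: (posnP i) => [-> | i0]; first by rewrite (leq_trans (geq_minl _ _)).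
case: (ltnP i.+1 (size s)) => i1; last first.
  by apply: (@leq_trans 1) => //; apply: (leq_trans (geq_minr _ _)); rewrite leq_subLR addn1.
have nx : nth x s i = x by apply: nth_index.
have fp : f x (nth x s i.-1) by rewrite fsym -{2}nx -{2}(prednK i0) fs // prednK.
have fn : f x (nth x s i.+1) by rewrite -{1}nx fs.
have : y \in [set nth x s i.-1; nth x s i.+1].
  suff -> : [set nth x s i.-1; nth x s i.+1] = [set z | f x z] by rewrite inE.
  apply/eqP; rewrite eqEcard; apply/andP; split.
    by apply/subsetP => z; rewrite !inE => /orP[] /eqP->.
  have i1' : i.-1 < size s by apply: leq_ltn_trans (leq_pred i) si.
  rewrite cards2 nth_uniq //.
  by apply: leq_trans (deg2 x) _; case: eqP => //; lia.
have i1' : i.-1 < size s by apply: leq_ltn_trans (leq_pred i) si.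
rewrite !inE => /orP[] /eqP->; rewrite mem_nth // index_uniq //; move: i0 i1; clear; lia.
Qed.

(** A maximal packing [F] of [f]-paths on [g] vertices is hit by an independent transversal [X]. On
    a path with [3 * g] vertices off [X], the middle third is too deep to be reached by a member of
    [F], which has a vertex off the path; so it could be added to [F]. *)
Lemma break_paths (e : rel T) : 0 < g -> symmetric e -> irreflexive e ->
    (forall x, 4 * #|[set y | e x y]| <= g) ->
  exists2 X : {set T}, {in X &, forall x y, ~~ e x y} &
    forall s, uniq s -> sorted f s -> {in s, forall x, x \notin X} -> size s < 3 * g.
Proof.
move=> g_gt0 esym eirr dege.
pose P := [set [set x in (t : seq T)] | t : g.-tuple T & uniq t && sorted f t].
have [F /maxsetP[/andP[trF /subsetP FP] Fmax] _] :
    {F | maxset (fun F : {set {set T}} => trivIset F && (F \subset P)) F & set0 \subset F}.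
  by apply: maxset_exists; rewrite sub0set andbT; apply/trivIsetP => A B; rewrite inE.
have cardF (A : {set T}) : A \in F -> #|A| = g.
  move=> /FP/imsetP[t]; rewrite inE => /andP[ut _] ->.
  by rewrite cardsE (card_uniqP ut) size_tuple.
have degd x : #|[set y | e x y]| <= g %/ 4 by rewrite leq_divRL // mulnC.
have [|X Xe XF] := independent_transversal esym eirr degd g_gt0 _ trF cardF.
  by rewrite mulnC leq_trunc_div.
exists X => // s0 us0 fs0 s0X; rewrite ltnNge; apply/negP => gs0.
pose s := take (3 * g) s0.
have us : uniq s by apply: take_uniq.
have fs : sorted f s by apply: take_sorted.
have ss : size s = 3 * g by apply: size_takel.
have sX x : x \in s -> x \notin X by move=> /mem_take/s0X.
(* The number of steps needed to leave [s] through its nearer end. *)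
pose h x := if x \in s then minn (index x s).+1 (size s - index x s) else 0.
have hf x y : f x y -> h x <= (h y).+1 by apply: depth_lipschitz.
pose t := take g (drop g s).
have st : size t == g by rewrite /t size_takel // size_drop ss; lia.
pose B := [set x in t].
have hB x : x \in B -> g < h x.
  rewrite inE => xt; have xs : x \in s by apply: mem_drop (mem_take xt).
  rewrite /h xs ss.
  have -> : index x s = g + index x t.
    have xd := mem_take xt.
    have ug : x \notin take g s.
      by move: us; rewrite -{1}(cat_take_drop g s) cat_uniq => /and3P[_ /hasPn/(_ x xd)].
    rewrite -{1}(cat_take_drop g s) index_cat (negPf ug) size_takel ?ss; last by lia.
    by rewrite -{1}(cat_take_drop g (drop g s)) index_cat xt.
  by have := xt; rewrite -index_mem (eqP st); lia.
have BP : B \in P.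
  apply/imsetP; exists (Tuple st) => //; rewrite inE /=.
  by rewrite take_uniq ?drop_uniq //= take_sorted // drop_sorted.
have disj A : A \in F -> [disjoint A & B].
  move=> AF; rewrite -setI_eq0; apply/eqP/setP => z; rewrite !inE.
  apply/negbTE/negP => /andP[zA zt]; have /hB hz : z \in B by rewrite inE.
  have /FP/imsetP[a] := AF; rewrite inE => /andP[ua fa] EA.
  have /set0Pn[w /setIP[wX wA]] := XF A AF.
  have hw : h w = 0 by rewrite /h; case: ifP => // /sX; rewrite wX.
  move: zA wA; rewrite EA !inE => za wa.
  (* Along a member of [F], which has [g] vertices, [h] varies by less than [g]; yet it is 0 at [w]
     and above [g] at [z]. *)
  have := path_lipschitz z (i := index z a) (j := index w a) fsym hf fa.
  rewrite !index_mem !nth_index // za wa hw size_tuple add0n => /(_ isT isT).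
  by rewrite ltnNge (ltnW hz).
have BF : B \in F.
  rewrite -[F](Fmax (B |: F)) ?setU11 ?subsetUr //; apply/andP; split; last first.
    by apply/subsetP => A /setU1P[-> // | /FP].
  apply/trivIsetP => A C /setU1P[-> | AF] /setU1P[-> | CF] AC //.
  - by rewrite eqxx in AC.
  - by rewrite disjoint_sym disj.
  - exact: disj.
  - by have /trivIsetP := trF; apply.
have := disj B BF; rewrite -setI_eq0 setIid => /eqP B0.
by have := cardF B BF; rewrite B0 cards0; lia.
Qed.

End Break.

(** As [d < 3 * q], the defective coloring leaves each vertex at most two neighbors of its own
    color, and [break_paths] applies to the color classes with [g = 4 * d + 1]. The set [X] gets the
    extra color [q]; it is independent, so no path of this color has two vertices. *)
Lemma short_path_coloring (T : finType) (e : rel T) (d q : nat) :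
    symmetric e -> irreflexive e -> (forall x, #|[set y | e x y]| <= d) -> d < 3 * q ->
  exists c : T -> nat, (forall x, c x < q.+1) /\
    forall s i, uniq s -> sorted e s -> {in s, forall x, c x = i} ->
      size s < 3 * (4 * d).+1.
Proof.
move=> esym eirr degd dq.
have q_gt0 : 0 < q by case: (q) dq; rewrite ?muln0.
have [c [cq cdeg]] := defective_coloring esym eirr q_gt0.
pose f x y := e x y && (c y == c x).
have fsym : symmetric f by move=> x y; rewrite /f esym eq_sym.
have deg2 x : #|[set y | f x y]| <= 2.
  by have := leq_trans (cdeg x) (degd x); rewrite /f; nia.
have deg4 x : 4 * #|[set y | e x y]| <= (4 * d).+1 by rewrite ltnW // ltnS leq_mul2l degd.
have [X Xe Xs] := break_paths fsym deg2 (ltn0Sn _) esym eirr deg4.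
exists (fun x => if x \in X then q else c x); split=> [x | s i us es sc].
  by case: ifP => // _; apply: ltnW; apply: cq.
case: (eqVneq i q) => [iq | iq].
  have sX x : x \in s -> x \in X.
    by move=> /sc; rewrite iq; case: ifP => // _ cx; move: (cq x); rewrite cx ltnn.
  case: s es sX {us sc} => [|x [|y s]] es sX; [by rewrite muln_gt0 | by rewrite /=; lia |].
  have /andP[exy _] : e x y && path e y s by [].
  by move: (Xe x y); rewrite exy !sX ?inE ?eqxx ?orbT // => /(_ isT isT).
have sX x : x \in s -> x \notin X.
  by move=> /sc; case: ifP => // _ qi; rewrite qi eqxx in iq.
have allss : all (mem s) s by apply/allP.
apply: Xs => //; apply: sub_in_sorted allss es.
move=> x y xs ys exy; rewrite /f exy /=.
by move: (sc x xs) (sc y ys); rewrite (negPf (sX _ xs)) (negPf (sX _ ys)) => -> ->.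
Qed.

(** * Lower bound: coloring k-graphs with few edges *)

Section EdgePath.
Variable V : finType.
Implicit Types (E : {set {set V}}) (X : {set V}) (s : seq {set V}).

Definition meets (A B : {set V}) := A :&: B != set0.

(* What is kept of a copy of the (k,l)-path in E, for l <= k/2. *)
Definition edge_path E s :=
  [/\ uniq s, {subset s <= E}, sorted meets s
    & forall v : V, count (fun e : {set V} => v \in e) s <= 2].

Definition path_free_coloring E (r m : nat) := exists c : {set V} -> nat,
  (forall e, e \in E -> c e < r) /\
  forall s i, edge_path E s -> {in s, forall e, c e = i} -> size s < m.

Definition degree E v := #|[set e in E | v \in e]|.

Definition avoiding E X := [set e in E | [disjoint e & X]].

Lemma size_edge_path_cover E X s : edge_path E s ->
  {in s, forall e : {set V}, ~~ [disjoint e & X]} -> size s <= 2 * #|X|.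
Proof.
move=> [_ _ _ s2] sX; apply: (@leq_trans (\sum_(v in X) count (fun e : {set V} => v \in e) s)).
  elim: s sX {s2} => //= e s IHs sX.
  rewrite big_split /= -add1n leq_add //; last by apply: IHs => x xs; apply: sX; rewrite inE xs orbT.
  have : ~~ [disjoint e & X] by apply: sX; rewrite mem_head.
  rewrite -setI_eq0 => /set0Pn[v /setIP[ve vX]].
  by rewrite (bigD1 v) //= ve.
by rewrite mulnC -sum_nat_const; apply: leq_sum => v _.
Qed.

Lemma path_free_coloring_cover E X r m : 2 * #|X| < m ->
  path_free_coloring (avoiding E X) r m -> path_free_coloring E r.+1 m.
Proof.
move=> Xm [c [cr cm]]; exists (fun e : {set V} => if [disjoint e & X] then c e else r); split.
  by move=> e eE; case: ifP => // eX; rewrite ltnS ltnW // cr // inE eE eX.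
move=> s i sE sc; case: (ltnP i r) => ir.
  have sX e : e \in s -> [disjoint e & X].
    by move=> /sc; case: ifP => // _ ri; move: ir; rewrite -ri ltnn.
  apply: (cm _ i) => [|e es]; last by rewrite -(sc _ es) sX.
  case: sE => us sE ss s2; split=> // e es; rewrite inE sE // sX //.
apply: leq_ltn_trans Xm; apply: (size_edge_path_cover sE) => e es.
apply/negP => eX; move: (sc e es); rewrite eX => ci.
have : c e < r by apply: cr; case: sE => _ sE _ _; rewrite inE sE // eX.
by rewrite ci; lia.
Qed.

(** Greedy deletion: as long as some vertex has degree at least [D], deleting it destroys at least
    [D] edges. *)
Lemma remove_large_degrees E D j : exists2 X : {set V}, #|X| <= j &
  (forall v, degree (avoiding E X) v < D) \/ #|avoiding E X| + j * D <= #|E|.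
Proof.
elim: j => [|j [X Xj [IHj|IHj]]].
- exists set0; first by rewrite cards0.
  by right; rewrite mul0n addn0; apply: subset_leq_card; apply/subsetP => e; rewrite inE => /andP[].
- by exists X; [apply: ltnW | left].
case: (boolP [forall v, degree (avoiding E X) v < D]) => [/forallP small | ].
  by exists X; [apply: ltnW | left].
rewrite negb_forall => /existsP[v]; rewrite -leqNgt => vD.
exists (v |: X); first by rewrite cardsU1; case: (v \in X) => //=; apply: ltnW.
right; apply: leq_trans IHj; rewrite mulSn addnA leq_add2r.
have avo (e : {set V}) : [disjoint e & v |: X] = (v \notin e) && [disjoint e & X].
  by rewrite disjoint_sym disjoints_subset subUset sub1set inE -disjoints_subset disjoint_sym.
rewrite -[leqRHS](cardsID [set e : {set V} | v \in e]) addnC leq_add //.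
  by apply: leq_trans vD _; apply: subset_leq_card; apply/subsetP => e; rewrite !inE.
by apply: subset_leq_card; apply/subsetP => e; rewrite !inE avo => /and3P[-> -> ->].
Qed.

(* One color is spent on the edges touching h vertices of large degree, as
   long as there are such vertices. *)
Lemma path_free_coloring_few_edges E0 (D : nat -> nat) h r m : 2 * h < m ->
    (forall i E, i < r -> E \subset E0 -> (forall v, degree E v < D i) ->
       path_free_coloring E i m) ->
  forall E, E \subset E0 -> #|E| < h * \sum_(i < r) D i -> path_free_coloring E r m.
Proof.
move=> hm; elim: r => [|r IHr] lowdeg E EE0; first by rewrite big_ord0 muln0.
rewrite big_ord_recr mulnDr /= => cE.
have [X Xh cX] := remove_large_degrees E (D r) h.
have aE : avoiding E X \subset E0.
  by apply: subset_trans EE0; apply/subsetP => e; rewrite inE => /andP[].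
apply: (@path_free_coloring_cover E X); first lia.
case: cX => [small|cX]; first exact: lowdeg.
(* The vertices of [X] have used up the summand [D r]; the edges left fit the budget of the first
   [r] colors. *)
apply: IHr => // [i E' ir|]; first by apply: lowdeg; apply: ltnW.
by rewrite -(ltn_add2r (h * D r)) (leq_ltn_trans cX).
Qed.

(** * The intersection graph of the edges *)

Definition linked E (e1 e2 : {set V}) :=
  [&& e1 \in E, e2 \in E, e1 != e2 & meets e1 e2].

Lemma linked_sym E : symmetric (linked E).
Proof. by move=> e1 e2; rewrite /linked /meets eq_sym setIC andbCA. Qed.

Lemma linked_irr E : irreflexive (linked E).
Proof. by move=> e; rewrite /linked eqxx !andbF. Qed.

Lemma linked_degree E k d (e1 : {set V}) : (forall e : {set V}, e \in E -> #|e| = k) ->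
  (forall v, degree E v <= d.+1) -> #|[set e2 | linked E e1 e2]| <= k * d.
Proof.
move=> Ek Ed; case: (boolP (e1 \in E)) => eE; last first.
  rewrite (_ : [set e2 | _] = set0) ?cards0 //; apply/setP => e2.
  by rewrite !inE /linked (negPf eE).
have sub : [set e2 | linked E e1 e2] \subset
    \bigcup_(v in e1) ([set e in E | v \in e] :\ e1).
  apply/subsetP => e2; rewrite inE => /and4P[_ e2E ne /set0Pn[v /setIP[v1 v2]]].
  by apply/bigcupP; exists v => //; rewrite !inE eq_sym ne e2E.
apply: leq_trans (subset_leq_card sub) _.
apply: (@leq_trans (\sum_(v in e1) #|[set e in E | v \in e] :\ e1|)).
  exact: card_bigcup_le.
rewrite -(Ek _ eE) -sum_nat_const; apply: leq_sum => v ve.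
by have := Ed v; rewrite /degree (cardsD1 e1) inE eE ve.
Qed.

Lemma edge_path_linked E s : edge_path E s -> sorted (linked E) s.
Proof.
move=> [us sE ss _]; case: s us sE ss => // e0 s us sE /(sortedP e0) ss.
apply/(sortedP e0) => i si.
have si' := ltnW si.
by rewrite /linked !sE ?mem_nth // nth_uniq // ss // ltn_eqF.
Qed.

Lemma path_free_coloring_thirds E k d q m :
    (forall e : {set V}, e \in E -> #|e| = k) -> (forall v, degree E v <= d.+1) ->
    k * d < 3 * q -> 3 * (4 * (k * d)).+1 <= m ->
  path_free_coloring E q.+1 m.
Proof.
move=> Ek Ed kdq kdm.
have deg e := @linked_degree E k d e Ek Ed.
have [c [cq cs]] := short_path_coloring (@linked_sym E) (@linked_irr E) deg kdq.
exists c; split=> // s i sE sc; apply: leq_trans kdm.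
by apply: (cs s i) => //; [case: sE | apply: edge_path_linked].
Qed.

(** With more colors than the bound [k * d] on the degrees of the intersection graph, the defective
    coloring is proper, so two consecutive edges of a path differ in color. *)
Lemma path_free_coloring_proper E k d q m :
    (forall e : {set V}, e \in E -> #|e| = k) -> (forall v, degree E v <= d.+1) ->
    k * d < q -> 1 < m ->
  path_free_coloring E q m.
Proof.
move=> Ek Ed kdq m1.
have q0 : 0 < q by lia.
have [c [cq cs]] := defective_coloring (@linked_sym E) (@linked_irr E) q0.
exists c; split=> // s i sE sc.
have := edge_path_linked sE; case: s sE sc => [|e1 [|e2 s]] sE sc //=; first by lia.
case/andP=> e12 _; have := leq_trans (cs e1) (@linked_degree E k d e1 Ek Ed).
set A := [set _ | _ & _] => cA.
have : e2 \in A by rewrite inE e12 !sc ?inE ?eqxx ?orbT.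
have : #|A| = 0 by nia.
by move/cards0_eq->; rewrite inE.
Qed.

Lemma path_free_coloring_degree0 E k q m : (forall e : {set V}, e \in E -> #|e| = k) ->
  0 < k -> (forall v, degree E v < 1) -> 0 < m -> path_free_coloring E q m.
Proof.
move=> Ek k0 E0 m0; have noE e : e \notin E.
  apply/negP => eE; have /card_gt0P[v ve] : 0 < #|e| by rewrite Ek.
  have : 0 < degree E v by apply/card_gt0P; exists e; rewrite inE eE.
  by rewrite ltnNge -ltnS E0.
exists (fun=> 0); split=> [e eE | [|e s] i [_ sE _ _] _ //].
  by have := noE e; rewrite eE.
by have := noE e; rewrite sE ?mem_head.
Qed.

End EdgePath.

(** The images of the path edges, in order, form an [edge_path] with [m] edges; [2 * l <= k] keeps
    every vertex on at most two of them. *)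
Lemma arrows_no_coloring k l m r (G : kgraph k) : 0 < l -> 2 * l <= k ->
  arrows r G (path_graph k l m) -> ~ path_free_coloring (edges G) r m.
Proof.
move=> l0 lk arr [c [cr cm]].
have [i ir [f [f_inj fE]]] := arr c cr.
pose F j := f @: [set v : 'I_(path_order k l m) | j * (k - l) <= v < j * (k - l) + k].
have FE j (jm : j < m) : F j = f @: path_edge k l (Ordinal jm) by [].
have pE (j : 'I_m) : path_edge k l j \in edges (path_graph k l m).
  by apply/imsetP; exists j.
pose s := mkseq F m.
have kl0 : 0 < k - l by lia.
suff sE : edge_path (edges G) s.
  have := cm s i sE; rewrite size_mkseq ltnn; case/(_ _)/Bool.diff_false_true.
  by move=> e /mapP[j]; rewrite mem_iota add0n => jm ->; rewrite (FE _ jm); case: (fE _ (pE (Ordinal jm))).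
have pos j t : j < m -> t < k -> j * (k - l) + t < path_order k l m.
  rewrite /path_order => jm tk.
  have : j * (k - l) <= m.-1 * (k - l) by rewrite leq_mul2r; apply/orP; right; lia.
  by lia.
split.
- rewrite /s /mkseq map_inj_in_uniq ?iota_uniq // => a b.
  rewrite !mem_iota !add0n /= => am bm /(imset_inj f_inj)/setP E.
  have pa := pos a 0 am (leq_trans l0 (leq_trans (leq_addr _ _) lk)).
  have pb := pos b 0 bm (leq_trans l0 (leq_trans (leq_addr _ _) lk)).
  have := E (Ordinal pa); have := E (Ordinal pb); rewrite !inE /= !addn0.
  have le x y : x * (k - l) <= y * (k - l) = (x <= y) by rewrite leq_pmul2r.
  rewrite !le !leqnn /=; lia.
- move=> e /mapP[j]; rewrite mem_iota add0n => jm ->.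
  by rewrite (FE _ jm); case: (fE _ (pE (Ordinal jm))).
- apply/(sortedP set0) => j; rewrite size_mkseq => jm.
  rewrite !nth_mkseq ?(ltnW jm) //; apply/set0Pn.
  have pj := pos j.+1 0 jm (leq_trans l0 (leq_trans (leq_addr _ _) lk)).
  exists (f (Ordinal pj)); rewrite inE !imset_f // inE /= ?addn0 ?mulSn; lia.
- move=> v; case: (boolP (v \in codom f)) => [/codomP[p ->] | vf].
    (* Vertex [p] lies in block [q] of length [k - l]. As [k <= 2 * (k - l)], edge [j] is covered by
       blocks [j] and [j + 1], so only the edges [q] and [q - 1] can contain [p]. *)
    pose q := p %/ (k - l).
    rewrite count_map -size_filter; apply: (@uniq_leq_size _ _ [:: q; q.-1]).
      by rewrite filter_uniq ?iota_uniq.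
    move=> j; rewrite mem_filter => /andP[/=]; rewrite mem_imset // !inE => /andP[j1 j2] _.
    have : j <= q by rewrite leq_divRL.
    have : q < j.+2 by rewrite ltn_divLR // !mulSn; lia.
    lia.
  rewrite (eq_in_count (a2 := pred0)) ?count_pred0 // => e /mapP[j _ ->] /=.
  by apply/negbTE; apply: contra vf => /imsetP[p _ ->]; apply: codom_f.
Qed.

(** * Blow-ups of graphs and an upper bound for the Ramsey number *)

Lemma distinct_representatives (B : finType) m (W : nat -> {set B}) :
    (forall i, i < m -> m <= #|W i|) ->
  exists2 s : seq B, uniq s /\ size s = m & forall b0 i, i < m -> nth b0 s i \in W i.
Proof.
move=> Wm; suff : forall j, j <= m -> exists2 s : seq B, uniq s /\ size s = j &
    forall b0 i, i < j -> nth b0 s i \in W i by apply.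
elim=> [|j IHj] jm; first by exists [::].
have [s [us sj] sW] := IHj (ltnW jm).
have /subsetPn[w wW ws] : ~~ (W j \subset s).
  apply/negP => /subset_leq_card; rewrite (card_uniqP us) sj.
  by have := Wm j jm; lia.
exists (rcons s w); first by rewrite rcons_uniq us size_rcons sj andbT.
move=> b0 i; rewrite ltnS nth_rcons sj; case: ltngtP => // [ij | ->] _; last by [].
exact: sW.
Qed.

Section DensePath.
Variables (A : finType) (F : {set {set A}}).
Hypothesis F2 : forall f : {set A}, f \in F -> #|f| = 2.

Definition nbrs (U : {set A}) x := [set y in U | [set x; y] \in F].

Lemma min_degree_path m (U : {set A}) x0 : x0 \in U ->
    (forall x, x \in U -> m <= #|nbrs U x|) ->
  exists u, [/\ uniq u, size u = m.+1 & sorted (fun x y => [set x; y] \in F) u].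
Proof.
move=> x0U deg; suff : forall j, j <= m -> exists x u, [/\ all (mem U) (x :: u), uniq (x :: u),
    size u = j & path (fun x y => [set x; y] \in F) x u].
  by move=> /(_ m (leqnn m))[x [u [_ ux um xu]]]; exists (x :: u); split; rewrite //= um.
elim=> [|j IHj] jm; first by exists x0, [::]; rewrite /= x0U.
have [x [u [/andP[xU uU] ux uj xu]]] := IHj (ltnW jm).
have /subsetPn[y] : ~~ (nbrs U x \subset u).
  have /andP[_ uu] := ux.
  apply/negP => /subset_leq_card; rewrite (card_uniqP uu) uj.
  by have := deg x xU; lia.
rewrite inE => /andP[yU xy] yu; exists y, (x :: u); split=> //=.
- by apply/and3P.
- rewrite inE negb_or yu andbT -/(uniq (x :: u)) ux andbT.
  by apply/eqP => yx; have := F2 xy; rewrite yx setUid cards1.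
- by rewrite uj.
- by rewrite setUC xy.
Qed.

(** Deleting a vertex of degree at most [m] loses at most [m] edges, so the density hypothesis
    survives. It fails on the empty set, so at some point all degrees exceed [m] and a path can be
    grown greedily. *)
Lemma dense_path m : m * #|A| < #|F| ->
  exists u, [/\ uniq u, size u = m.+2 & sorted (fun x y => [set x; y] \in F) u].
Proof.
have -> : F = [set f in F | f \subset [set: A]] by apply/setP => f; rewrite inE subsetT andbT.
have /(_ #|[set: A]|) H : forall n (U : {set A}), #|U| = n -> m * n < #|[set f in F | f \subset U]| ->
    exists u, [/\ uniq u, size u = m.+2 & sorted (fun x y => [set x; y] \in F) u]; last first.
  rewrite -cardsT => /(H _ erefl) [u [uu um su]]; exists u; split=> //.
  by apply: sub_sorted su => x y; rewrite inE subsetT andbT.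
elim=> [|n IHn] U Un dU.
  have /card_gt0P[f] : 0 < #|[set f in F | f \subset U]| by lia.
  rewrite inE (cards0_eq Un) subset0 => /andP[fF /eqP f0].
  by have := F2 fF; rewrite f0 cards0.
case: (boolP [forall x in U, m < #|nbrs U x|]) => [/forall_inP deg | ].
  have /card_gt0P[x0 x0U] : 0 < #|U| by rewrite Un.
  exact: min_degree_path x0U deg.
rewrite negb_forall_in => /exists_inP[x xU]; rewrite -leqNgt => xm.
have Ux : #|U :\ x| = n by move: Un; rewrite (cardsD1 x) xU => -[].
apply: (IHn _ Ux); move: dU; rewrite -(cardsID [set f : {set A} | x \in f]) mulnS.
set a := #|_|; set b := #|_|.
have : a <= m.
  apply: leq_trans xm; rewrite /a.
  apply: leq_trans (leq_imset_card (fun y => [set x; y]) _).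
  apply: subset_leq_card; apply/subsetP => f; rewrite !inE => /andP[/andP[fF fU] xf].
  have /cards2P[y [z [yz E]]] : #|f| == 2 by apply/eqP/F2.
  wlog xy : y z yz E / x = y => [H|].
    have : (x == y) || (x == z) by move: xf; rewrite E !inE.
    case/orP => /eqP xE; first exact: (H y z).
    by apply: (H z y) => //; rewrite 1?eq_sym // E setUC.
  subst y; apply/imsetP; exists z; rewrite // inE -E fF andbT.
  by apply: (subsetP fU); rewrite E !inE eqxx orbT.
have : b <= #|[set f in F | f \subset U :\ x]|.
  by apply: subset_leq_card; apply/subsetP => f; rewrite !inE subsetD1 => /andP[-> /andP[-> ->]].
by lia.
Qed.

End DensePath.

Section Host.
Variables (A B : finType) (l c : nat).
Local Notation V := ((A * 'I_l) + (B * 'I_c))%type.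

(** In use, [c = k - 2 * l]. Private parts are indexed by a separate type [B], because a pair may be
    offered many of them, as in [complete_arrows], or a single one of its own, as in [blow_up]. *)
Definition blow_edge (f : {set A}) (w : B) : {set V} :=
  [set v | match v with inl p => p.1 \in f | inr p => p.1 == w end].

Lemma card_blow_edge (f : {set A}) w : #|f| = 2 -> #|blow_edge f w| = 2 * l + c.
Proof.
move=> f2.
have -> : blow_edge f w = inl @: setX f [set: 'I_l] :|: inr @: setX [set w] [set: 'I_c].
  apply/setP => -[p|p]; rewrite !inE.
    rewrite (mem_imset _ _ inl_inj) !inE andbT orbC (_ : (inl p \in _) = false) //.
    by apply/negbTE/imsetP => -[].
  rewrite (mem_imset _ _ inr_inj) !inE andbT (_ : (inr p \in _) = false) //.
  by apply/negbTE/imsetP => -[].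
rewrite cardsU (_ : _ :&: _ = set0) ?cards0 ?subn0; last first.
  by apply/setP => v; rewrite !inE; apply/negbTE/negP => /andP[/imsetP[p _ ->] /imsetP[]].
rewrite !card_imset; [|exact: inr_inj|exact: inl_inj].
by rewrite !cardsX f2 !cardsT !card_ord cards1 mul1n.
Qed.

(** Cut the path into blocks of [l + c = k - l] vertices. Block [q] starts with the [l] copies of
    [u q] and goes on with the private part [w q]. Edge [i] is block [i] with the first [l] vertices
    of block [i + 1]; the last block, [m], has only these. *)
Lemma blow_path k m (u : nat -> A) (w : nat -> B) : 0 < l -> k = 2 * l + c -> 0 < m ->
    {in [pred i | i <= m] &, injective u} -> {in [pred i | i < m] &, injective w} ->
  exists f : 'I_(path_order k l m) -> V, injective f /\
    forall i : 'I_m, f @: path_edge k l i = blow_edge [set u i; u i.+1] (w i).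
Proof.
move=> l0 kE m0 u_inj w_inj; have K0 : 0 < l + c by lia.
have kl : k - l = l + c by lia.
pose t (p : nat) : 'I_(l + c) := Ordinal (ltn_pmod p K0).
pose f (p : 'I_(path_order k l m)) : V := match split (t p) with
  | inl a => inl (u (p %/ (l + c)), a) | inr b => inr (w (p %/ (l + c)), b) end.
have ord (p : 'I_(path_order k l m)) : p < m * (l + c) + l.
  by apply: leq_trans (ltn_ord p) _; rewrite /path_order kl; case: (m) m0 => // m' _; rewrite mulSn /=; lia.
have f_inj : injective f.
  move=> p p'; rewrite /f.
  have qm (x : 'I_(path_order k l m)) : x %/ (l + c) <= m.
    by rewrite -ltnS ltn_divLR //; apply: leq_trans (ord x) _; rewrite mulSn; lia.
  have qm' (x : 'I_(path_order k l m)) : l <= x %% (l + c) -> x %/ (l + c) < m.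
    move=> lx; rewrite ltn_neqAle qm andbT; apply/eqP => E.
    by have := ord x; rewrite {1}(divn_eq x (l + c)) E; lia.
  have eqp : p %/ (l + c) = p' %/ (l + c) -> p %% (l + c) = p' %% (l + c) -> p = p'.
    by move=> E1 E2; apply: val_inj; rewrite /= (divn_eq p (l + c)) E1 E2 -divn_eq.
  case: (splitP (t p)) => [a pa|b pb]; case: (splitP (t p')) => [a' pa'|b' pb'] // [].
    move/u_inj; rewrite !inE !qm => /(_ isT isT) E ab; apply: eqp => //.
    by rewrite /= in pa pa'; rewrite pa pa' ab.
  rewrite /= in pb pb'.
  move/w_inj; rewrite !inE !qm' ?pb ?pb' ?leq_addr // => /(_ isT isT) E ab; apply: eqp => //.
  by rewrite pb pb' ab.
exists f; split=> // i.
have u2 : #|[set u i; u i.+1]| = 2.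
  rewrite cards2 (_ : u i != u i.+1) //; apply/eqP => /u_inj; rewrite !inE ltn_ord (ltnW (ltn_ord i)).
  by move=> /(_ isT isT); lia.
apply/eqP; rewrite eqEcard card_blow_edge // card_imset // card_path_edge -kE leqnn andbT.
apply/subsetP => v /imsetP[p]; rewrite inE kl => /andP[ip pi] -> {v}; rewrite /f inE.
have [q1 q2] : i <= p %/ (l + c) /\ (p %/ (l + c) <= i \/ p %/ (l + c) = i.+1 /\ p %% (l + c) < l).
  have q1 : i <= p %/ (l + c) by rewrite leq_divRL.
  split=> //; case: (leqP (p %/ (l + c)) i) => [|iq]; [by left | right].
  have qi : p %/ (l + c) < i.+2 by rewrite ltn_divLR // !mulSn; lia.
  have qE : p %/ (l + c) = i.+1 by lia.
  by split=> //; move: pi; rewrite {1}(divn_eq p (l + c)) qE mulSn; lia.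
case: (splitP (t p)) => [a /= pa | b /= pb]; rewrite /=.
  by case: q2 => [q2|[-> _]]; rewrite !inE ?eqxx ?orbT // (_ : p %/ (l + c) = i) ?eqxx //; lia.
case: q2 => [q2|[_]]; last by lia.
by rewrite (_ : p %/ (l + c) = i) //; lia.
Qed.

End Host.

Section Complete.
Variables (k : nat) (V : finType).
Lemma complete_card (e : {set V}) : e \in [set e : {set V} | #|e| == k] -> #|e| = k.
Proof. by rewrite inE => /eqP. Qed.
Definition complete_kgraph : kgraph k := KGraph complete_card.
End Complete.

(** Each pair has [s * m + 1] private parts, so some color is taken with more than [m] of them.
    There are [(s * m + 1) * (2 * s * m + 1)] pairs, more than [s * m * #|A|], so some color is
    popular on a path of [m + 1] pairs, whose private parts can then be chosen distinct. *)
Lemma complete_arrows k l c s m : 0 < l -> k = 2 * l + c ->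
  arrows s (complete_kgraph k (('I_(2 * (s * m)).+2 * 'I_l) + ('I_(s * m).+1 * 'I_c))%type)
    (path_graph k l m.+1).
Proof.
move=> l0 kE col cols; set A := 'I_(2 * (s * m)).+2; set B := 'I_(s * m).+1.
pose W (f : {set A}) i := [set w : B | col (blow_edge l c f w) == i].
have blow_in (f : {set A}) (w : B) : #|f| = 2 ->
    blow_edge l c f w \in edges (complete_kgraph k ((A * 'I_l) + (B * 'I_c))%type).
  by move=> f2; rewrite inE card_blow_edge // kE.
have chiP (f : {set A}) : exists i : nat, #|f| = 2 -> i < s /\ m < #|W f i|.
  case: (boolP (#|f| == 2)) => [/eqP f2 | /eqP f2]; last by exists 0.
  case: (boolP [exists i : 'I_s, m < #|W f i|]) => [/existsP[i im] | ]; first by exists i.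
  rewrite negb_exists => /forallP small; exfalso.
  have : #|[set: B]| <= \sum_(i < s) #|W f i|.
    have sub : [set: B] \subset \bigcup_(i < s) W f i.
      apply/subsetP => w _; have cs := cols _ (blow_in f w f2).
      by apply/bigcupP; exists (Ordinal cs); rewrite // inE.
    apply: leq_trans (subset_leq_card sub) _.
    exact: card_bigcup_le.
  rewrite cardsT card_ord leqNgt => /negP; apply; rewrite ltnS.
  apply: (@leq_trans (\sum_(i < s) m)); last by rewrite sum_nat_const card_ord.
  by apply: leq_sum => i _; rewrite leqNgt.
have [chi chiE] := choice chiP.
pose F i := [set f : {set A} | (#|f| == 2) && (chi f == i)].
have [i [ir Fi]] : exists i, i < s /\ m * #|A| < #|F i|.
  case: (boolP [exists i : 'I_s, m * #|A| < #|F i|]) => [/existsP[i im] | ]; first by exists i.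
  rewrite negb_exists => /forallP small; exfalso.
  have : #|[set f : {set A} | #|f| == 2]| <= \sum_(i < s) #|F i|.
    have sub : [set f : {set A} | #|f| == 2] \subset \bigcup_(i < s) F i.
      apply/subsetP => f; rewrite inE => f2; have [cs _] := chiE f (eqP f2).
      by apply/bigcupP; exists (Ordinal cs); rewrite // inE f2 /=.
    apply: leq_trans (subset_leq_card sub) _.
    exact: card_bigcup_le.
  have : \sum_(i < s) #|F i| <= \sum_(i < s) m * #|A| by apply: leq_sum => i _; rewrite leqNgt.
  rewrite sum_nat_const card_draws !card_ord bin2.
  have -> : ((2 * (s * m)).+2 * (2 * (s * m)).+2.-1)./2 = (s * m).+1 * (2 * (s * m)).+1.
    by rewrite -[RHS]doubleK; congr _./2; rewrite -pred_Sn; lia.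
  by nia.
have F2 f : f \in F i -> #|f| = 2 by rewrite inE => /andP[/eqP].
have [u [uu um su]] := dense_path F2 Fi.
have x0 : A := ord0; have b0 : B := ord0.
pose U j := nth x0 u j.
have UF j : j < m.+1 -> [set U j; U j.+1] \in F i.
  by move=> jm; move/(sortedP x0): su; apply; rewrite um.
have [w [uw wm] wW] : exists2 w : seq B, uniq w /\ size w = m.+1 &
    forall b0 j, j < m.+1 -> nth b0 w j \in W [set U j; U j.+1] i.
  apply: distinct_representatives => j /UF; rewrite inE => /andP[/eqP f2 /eqP <-].
  by case: (chiE _ f2).
have U_inj : {in [pred j | j <= m.+1] &, injective U}.
  by move=> a b; rewrite !inE => am bm /eqP; rewrite nth_uniq ?um // => /eqP.
have w_inj : {in [pred j | j < m.+1] &, injective (nth b0 w)}.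
  by move=> a b; rewrite !inE => am bm /eqP; rewrite nth_uniq ?wm // => /eqP.
have [f [f_inj fE]] := blow_path l0 kE (ltn0Sn m) U_inj w_inj.
exists i => //; exists f; split=> // e /imsetP[j _ ->]; rewrite fE; split.
  by apply: blow_in; apply: F2; apply: UF.
by have := wW b0 j (ltn_ord j); rewrite inE => /eqP.
Qed.

Section BlowUp.
Variables (k l c : nat) (A : finType) (F : {set {set A}}).
Hypotheses (kE : k = 2 * l + c) (F2 : forall f : {set A}, f \in F -> #|f| = 2).

Lemma blow_up_card (e : {set (A * 'I_l) + ({set A} * 'I_c)}) :
  e \in [set blow_edge l c f f | f in F] -> #|e| = k.
Proof. by case/imsetP => f fF ->; rewrite card_blow_edge ?kE // F2. Qed.

Definition blow_up : kgraph k := KGraph blow_up_card.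

(** The private part of an edge [f] is indexed by [f] itself, so distinct edges of a monochromatic
    graph path have disjoint private parts. *)
Lemma blow_up_arrows r m : 0 < l -> 0 < m ->
    (forall chi : {set A} -> nat, (forall f, f \in F -> chi f < r) ->
       exists i u, [/\ i < r, uniq u, size u = m.+1 &
         sorted (fun x y => ([set x; y] \in F) && (chi [set x; y] == i)) u]) ->
  arrows r blow_up (path_graph k l m).
Proof.
move=> l0 m0 FP col colr.
have [|i [u [ir uu um /sortedP su]]] := FP (fun f => col (blow_edge l c f f)).
  by move=> f fF; apply: colr; apply: imset_f.
have x0 : A by case: (u) um.
pose U j := nth x0 u j.
have UF j : j < m -> [set U j; U j.+1] \in F /\ col (blow_edge l c [set U j; U j.+1] [set U j; U j.+1]) = i.
  by move=> jm; have := su x0 j; rewrite um ltnS => /(_ jm)/andP[? /eqP].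
have U_inj : {in [pred j | j <= m] &, injective U}.
  by move=> a b; rewrite !inE => am bm /eqP; rewrite nth_uniq ?um // => /eqP.
have w_inj : {in [pred j | j < m] &, injective (fun j => [set U j; U j.+1])}.
  move=> a b; rewrite !inE => am bm /setP E.
  have := E (U a); have := E (U a.+1); have := E (U b).
  rewrite !inE !eqxx ?orbT /U !nth_uniq ?um; lia.
have [f [f_inj fE]] := blow_path l0 kE m0 U_inj w_inj.
exists i => //; exists f; split=> // e /imsetP[j _ ->]; rewrite fE.
by have [jF jc] := UF j (ltn_ord j); split=> //; apply: imset_f.
Qed.

End BlowUp.

(** * Sparse graphs with many edges *)

(* The state of a depth-first search on U: S is the set of finished vertices
   and s the stack, which is a path. *)
Lemma depth_first_search (A : finType) (e : rel A) (U : {set A}) a : symmetric e -> a <= #|U| ->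
  exists (S : {set A}) (s : seq A), [/\ #|S| = a, S \subset U, uniq s, sorted e s &
    forall x y, x \in S -> y \in U -> e x y -> y \in S \/ y \in s].
Proof.
move=> esym aU.
(* Each step pushes a vertex or moves one from the stack to [S]; both raise [2 * #|S| + size s] by
   one. This sum never exceeds [2 * #|U|], so the search reaches [#|S| = a] in time. *)
have /(_ (2 * #|U|).+1) [S [s [[[SU us] sU Ss es Se] [|]]]] : forall n, exists (S : {set A}) (s : seq A),
    [/\ S \subset U /\ uniq s, {subset s <= U}, {in s, forall x, x \notin S}, sorted e s &
      forall x y, x \in S -> y \in U -> e x y -> y \in S \/ y \in s]
    /\ (#|S| = a \/ #|S| <= a /\ 2 * #|S| + size s = n).
- elim=> [|n [S [s [[[SU us] sU Ss es Se] [Sa | [Sa Sn]]]]]].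
  + exists set0, [::]; split; last by right; rewrite cards0.
    by split=> // [|x y]; rewrite ?sub0set ?inE.
  + by exists S, s; split; [split | left].
  case: (eqVneq #|S| a) => [Sa' | Sna]; first by exists S, s; split; [split | left].
  have Slt : #|S| < a by rewrite ltn_neqAle Sna.
  case: s us sU Ss es Se Sn => [|x s] us sU Ss es Se Sn.
    have /subsetPn[x xU xS] : ~~ (U \subset S).
      by apply/negP => /subset_leq_card; lia.
    exists S, [:: x]; split; last by right; rewrite /= in Sn *; lia.
    split=> //; first by move=> y; rewrite inE => /eqP->.
      by move=> y; rewrite inE => /eqP->.
    by move=> y z yS zU yz; left; case: (Se y z yS zU yz).
  case: (boolP [exists y in U, [&& e x y, y \notin S & y \notin x :: s]]).
    case/exists_inP => y yU /and3P[xy yS ys]; exists S, (y :: x :: s); split.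
      split=> //; first by rewrite cons_uniq ys us.
      - by move=> z; rewrite inE => /predU1P[-> // | /sU].
      - by move=> z; rewrite inE => /predU1P[-> // | /Ss].
      - by rewrite /= esym xy.
      - by move=> z w zS wU zw; case: (Se z w zS wU zw) => ?; [left | right; rewrite inE; apply/orP; right].
    by right; split=> //; rewrite -Sn /=; lia.
  rewrite negb_exists_in => /forall_inP stuck.
  have xS : x \notin S by apply: Ss; rewrite mem_head.
  exists (x |: S), s; split; last first.
    by right; rewrite cardsU1 xS; split; [lia | rewrite -Sn /=; lia].
  have /andP[xs us'] := us.
  split=> //.
  - split=> //; apply/subsetP => z /setU1P[-> | zS]; last exact: (subsetP SU).
    by apply: sU; rewrite mem_head.
  - by move=> z zs; apply: sU; rewrite inE zs orbT.
  - move=> z zs; rewrite !inE negb_or Ss ?inE ?zs ?orbT // andbT.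
    by apply: contra xs => /eqP <-.
  - exact: path_sorted es.
  move=> z w; rewrite !inE => /predU1P[-> | zS] wU zw.
    have := stuck w wU; rewrite zw /= negb_and !negbK inE.
    by case: (w == x) => /=; [left | case: (w \in S) => /=; [left | right]].
  by case: (Se z w zS wU zw) => [-> | ]; [left; rewrite orbT | rewrite inE => /predU1P[-> | ]; [left; rewrite eqxx | right]].
- by move=> Sa; exists S, s.
case=> Sa Sn; have sub : #|S| + size s <= #|U|.
  have -> : size s = #|[set x in s]| by rewrite cardsE (card_uniqP us).
  have <- : #|S :|: [set x in s]| = #|S| + #|[set x in s]|.
    rewrite cardsU (_ : _ :&: _ = set0) ?cards0 ?subn0 //; apply/setP => x; rewrite !inE.
    by apply/negbTE/negP => /andP[xS /Ss]; rewrite xS.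
  by apply: subset_leq_card; apply/subsetP => x; rewrite !inE => /orP[/(subsetP SU) | /sU].
by lia.
Qed.

Section Sparse.
Variables (A : finType) (p t : nat).
Implicit Type F : {set {set A}}.

Definition spanned F (W : {set A}) := [set f in F | f \subset W].

(** Stop a depth-first search of [U] when [p] vertices are finished. The stack is a path, so it has
    fewer than [p] vertices, and it holds all neighbors in [U] of [S] outside [S]. Hence the edges
    meeting [S] lie in a set of at most [2 * p] vertices. Delete [S] and repeat. *)
Lemma spanned_no_path F n (U : {set A}) : (forall f : {set A}, f \in F -> #|f| = 2) ->
    (forall W : {set A}, #|W| <= 2 * p -> #|spanned F W| <= t) ->
    (forall u, uniq u -> sorted (fun x y => [set x; y] \in F) u -> size u <> p) ->
  #|U| <= n * p -> #|spanned F U| <= n * t.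
Proof.
move=> F2 sparse nopath; elim: n U => [|n IHn] U Un.
  rewrite leqn0 cards_eq0; apply/eqP/setP => f; rewrite !inE.
  apply/negbTE/negP => /andP[/F2 f2 /subset_leq_card]; rewrite f2; lia.
case: (leqP p #|U|) => [pU | Up]; last by rewrite (leq_trans (sparse U _)) ?mulSn ?leq_addr //; lia.
have esym : symmetric (fun x y => [set x; y] \in F) by move=> x y; rewrite setUC.
have [S [s [Sp SU us es Se]]] := depth_first_search esym pU.
have sp : size s < p.
  rewrite ltnNge; apply/negP => ps; apply: (nopath (take p s)); rewrite ?take_uniq ?take_sorted //.
  by rewrite size_takel.
have sub : spanned F U \subset spanned F (S :|: [set x in s]) :|: spanned F (U :\: S).
  apply/subsetP => f; rewrite !inE => /andP[fF fU]; rewrite fF /=.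
  case: (boolP [disjoint f & S]) => [fS | ].
    by apply/orP; right; rewrite subsetD fU.
  rewrite -setI_eq0 => /set0Pn[x /setIP[xf xS]]; apply/orP; left; apply/subsetP => y yf.
  case: (eqVneq y x) => [-> | yx]; first by rewrite inE xS.
  have fE : [set x; y] = f.
    apply/eqP; rewrite eqEcard cards2 eq_sym yx F2 // andbT.
    by apply/subsetP => z; rewrite !inE => /orP[] /eqP->.
  by rewrite !inE; case: (Se x y xS (subsetP fU _ yf)) => [|-> | ->]; rewrite ?fE ?orbT.
apply: leq_trans (subset_leq_card sub) _; apply: leq_trans (leq_card_setU _ _) _.
rewrite mulSn leq_add //.
  apply: sparse; apply: leq_trans (leq_card_setU _ _) _.
  by rewrite Sp cardsE (card_uniqP us); lia.
by apply: IHn; rewrite cardsDS // Sp; rewrite mulSn in Un; lia.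
Qed.

Lemma sparse_arrows F n r : (forall f : {set A}, f \in F -> #|f| = 2) ->
    (forall W : {set A}, #|W| <= 2 * p -> #|spanned F W| <= t) ->
    #|A| <= n * p -> r * (n * t) < #|F| ->
  forall chi : {set A} -> nat, (forall f, f \in F -> chi f < r) ->
    exists i u, [/\ i < r, uniq u, size u = p &
      sorted (fun x y => ([set x; y] \in F) && (chi [set x; y] == i)) u].
Proof.
move=> F2 sparse An Fr chi chir; apply: contrapT => nomono.
have : #|F| <= \sum_(i < r) #|[set f in F | chi f == i]|.
  have sub : F \subset \bigcup_(i < r) [set f in F | chi f == i].
    apply/subsetP => f fF; apply/bigcupP.
    by exists (Ordinal (chir f fF)); rewrite // inE fF /=.
  apply: leq_trans (subset_leq_card sub) _.
  exact: card_bigcup_le.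
suff : \sum_(i < r) #|[set f in F | chi f == i]| <= r * (n * t) by lia.
have -> : r * (n * t) = \sum_(i < r) n * t by rewrite sum_nat_const card_ord.
apply: leq_sum => i _.
have -> : [set f in F | chi f == i] = spanned [set f in F | chi f == i] [set: A].
  by apply/setP => f; rewrite !inE subsetT andbT.
apply: spanned_no_path; rewrite ?cardsT //.
- by move=> f; rewrite inE => /andP[/F2].
- move=> W /sparse; apply: leq_trans; apply: subset_leq_card.
  by apply/subsetP => f; rewrite !inE => /andP[/andP[-> _] ->].
- move=> u uu su up; apply: nomono; exists i, u; split=> //.
  by apply: sub_sorted su => x y; rewrite inE.
Qed.

End Sparse.

(** * Binomial estimates and random sparse graphs *)

Lemma expnn_fact n : n ^ n <= 4 ^ n * n`!.
Proof.
have ffle a b : a ^ b <= (a + b) ^_ b.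
  elim: b => [|b IHb]; first by rewrite ffactn0.
  by rewrite addnS ffactSS expnS leq_mul //; lia.
(* The falling factorial is the central binomial coefficient times the factorial of [n], and that
   coefficient is at most [2 ^ (n + n)]. *)
apply: leq_trans (ffle n n) _; rewrite -bin_ffact leq_mul2r; apply/orP; right.
have -> : 4 ^ n = 2 ^ (n + n) by rewrite addnn -mul2n expnM.
rewrite -(subnKC (leq_addr n n)) addKn -[2]/(1 + 1) expnDn.
have nn : n < (n + n).+1 by lia.
by rewrite (bigD1 (Ordinal nn)) //= !exp1n !muln1 leq_addr.
Qed.

(** The usual bound [(e * a / b) ^ b] on binomial coefficients, with 4 in place of e and
    denominators cleared. *)
Lemma bin_expn_le a b : 'C(a, b) * b ^ b <= 4 ^ b * a ^ b.
Proof.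
have : 'C(a, b) * b`! <= a ^ b.
  rewrite bin_ffact; elim: b a => [|b IHb] [|a] //; rewrite ffactSS expnS leq_mul //.
  by apply: leq_trans (IHb a) _; case: b {IHb} => // b; rewrite leq_exp2r.
have := expnn_fact b; nia.
Qed.

(** The chance that a random [m]-subset of an [n]-set contains [s] given elements is a product of
    ratios [(m - i) / (n - i)], each at most [m / n]. *)
Lemma bin_sub_le n m s : s <= m -> m <= n ->
  'C(n - s, m - s) * n ^ s <= 'C(n, m) * m ^ s.
Proof.
move=> sm mn; elim: s sm => [|s IHs] sm; first by rewrite !subn0.
have := IHs (ltnW sm).
have [a na] : exists a, n - s = a.+1 by exists (n - s.+1); lia.
have [b mb] : exists b, m - s = b.+1 by exists (m - s.+1); lia.
have -> : n - s.+1 = a by lia.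
have -> : m - s.+1 = b by lia.
rewrite na mb !expnSr; have := mul_bin_diag a.+1 b; rewrite [a.+1.-1]/=.
set x := 'C(a, b); set y := 'C(_, _); set K := 'C(n, m) => E le.
have le2 : x * n <= y * m.
  rewrite -(leq_pmul2l (ltn0Sn a)) mulnA E.
  have : b.+1 * n <= a.+1 * m by nia.
  by nia.
apply: (@leq_trans (y * n ^ s * m)); first by nia.
by rewrite [leqRHS]mulnA leq_mul2r le orbT.
Qed.

Lemma card_draws_dense (T : finType) (E Q : {set T}) M s : Q \subset E -> s <= M ->
  #|[set F : {set T} | [&& F \subset E, #|F| == M & s <= #|F :&: Q|]]|
    <= 'C(#|Q|, s) * 'C(#|E| - s, M - s).
Proof.
move=> QE sM.
have sub : [set F : {set T} | [&& F \subset E, #|F| == M & s <= #|F :&: Q|]] \subset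
   \bigcup_(D in [set D : {set T} | D \subset Q & #|D| == s])
     [set D :|: F | F in [set F : {set T} | F \subset E :\: D & #|F| == M - s]].
  apply/subsetP => F; rewrite inE => /and3P[FE /eqP FM sF].
  have /set0Pn[D] : [set D : {set T} | D \subset F :&: Q & #|D| == s] != set0.
    by rewrite -card_gt0 cards_draws bin_gt0.
  rewrite inE subsetI => /andP[/andP[DF DQ] /eqP Ds].
  apply/bigcupP; exists D; first by rewrite inE DQ Ds /=.
  apply/imsetP; exists (F :\: D); last by rewrite -{1}(setID F D) (setIidPr DF).
  by rewrite inE setSD //= cardsDS // FM Ds.
apply: leq_trans (subset_leq_card sub) _.
rewrite -cards_draws -sum_nat_const.
apply: (@leq_trans (\sum_(D in [set D : {set T} | D \subset Q & #|D| == s])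
     #|[set D :|: F | F in [set F : {set T} | F \subset E :\: D & #|F| == M - s]]|)).
  exact: card_bigcup_le.
apply: leq_sum => D; rewrite inE => /andP[DQ /eqP Ds].
apply: leq_trans (leq_imset_card _ _) _.
by rewrite cards_draws cardsDS ?Ds // (subset_trans DQ).
Qed.

Lemma superset_card (A : finType) (W : {set A}) s : #|W| <= s -> s <= #|A| ->
  exists2 W' : {set A}, W \subset W' & #|W'| = s.
Proof.
move=> Ws sA.
have /set0Pn[D] : [set D : {set A} | D \subset ~: W & #|D| == s - #|W|] != set0.
  by rewrite -card_gt0 cards_draws bin_gt0; have := cardsC W; lia.
rewrite inE => /andP[DW /eqP Ds]; exists (W :|: D); first exact: subsetUl.
rewrite cardsU (_ : W :&: D = set0) ?cards0 ?Ds; first lia.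
by apply/eqP; rewrite setIC setI_eq0 disjoints_subset.
Qed.

Lemma card_bad_draws_lt r p L s M : 0 < r -> 0 < p -> r <= 2 ^ L ->
    2 * p * (6 + L) < s -> s <= M -> M <= 32 * r ^ 2 * s -> M <= 'C(32 * r * p, 2) ->
  'C(32 * r * p, 2 * p) * ('C('C(2 * p, 2), s) * 'C('C(32 * r * p, 2) - s, M - s))
    < 'C('C(32 * r * p, 2), M).
Proof.
move=> r0 p0 rL ps sM Ms MN.
set N := 32 * r * p; set E := 'C(2 * p, 2); set N2 := 'C(N, 2).
set Y := 'C(E, s); set Z := 'C(N2 - s, M - s); set K := 'C(N2, M).
have K0 : 0 < K by rewrite bin_gt0.
have EM : 8 * (E * M) <= s * N2.
  have : 2 * E = 2 * p * (2 * p).-1 by rewrite /E -mul_bin_diag bin1.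
  have : 2 * N2 = N * N.-1 by rewrite /N2 -mul_bin_diag bin1.
  rewrite -/E; clearbody E N2 => N2E EE.
  have : 256 * r ^ 2 * E <= N2.
    have -> : 256 * r ^ 2 * E = 16 * (r * p) * (16 * (r * (2 * p).-1)).
      by transitivity (128 * r ^ 2 * (2 * E)); [lia | rewrite EE; lia].
    have -> : N2 = 16 * (r * p) * N.-1 by move: N2E; rewrite {1}/N; lia.
    rewrite leq_pmul2l ?muln_gt0 ?r0 // /N.
    have -> : r * (2 * p).-1 = r * (2 * p) - r by rewrite -subn1 mulnBr muln1.
    by lia.
  move=> rE; apply: (@leq_trans (8 * (E * (32 * r ^ 2 * s)))).
    by rewrite !leq_mul2l Ms !orbT.
  have -> : 8 * (E * (32 * r ^ 2 * s)) = s * (256 * r ^ 2 * E) by lia.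
  by rewrite leq_mul2l rE orbT.
have X2 : 'C(N, 2 * p) < 2 ^ s.
  have p2 : 0 < (2 * p) ^ (2 * p) by rewrite expn_gt0; lia.
  apply: (@leq_ltn_trans (2 ^ (2 * p * (6 + L)))); last by rewrite ltn_exp2l.
  rewrite -(leq_pmul2r p2); apply: leq_trans (bin_expn_le _ _) _.
  rewrite -expnMn [2 * p * (6 + L)]mulnC [2 ^ _]expnM -expnMn leq_exp2r; last by lia.
  have -> : 2 ^ (6 + L) = 64 * 2 ^ L by rewrite expnD.
  rewrite /N; nia.
have YZ : 2 ^ s * (Y * Z) <= K.
  have := bin_expn_le E s; have := bin_sub_le sM MN; rewrite -/Y -/Z -/N -/N2 -/K => h1 h2.
  have sN : 0 < (s * N2) ^ s by rewrite expn_gt0 muln_gt0 (leq_trans _ MN) ?andbT; lia.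
  rewrite -(leq_pmul2r sN).
  apply: (@leq_trans ((8 * (E * M)) ^ s * K)).
    have -> : (8 * (E * M)) ^ s * K = 2 ^ s * ((4 ^ s * E ^ s) * (K * M ^ s)).
      by rewrite -[8]/(2 * 4) !expnMn; move: (2 ^ s) (4 ^ s) (E ^ s) (M ^ s) => *; lia.
    rewrite -mulnA leq_mul2l; apply/orP; right.
    have -> : Y * Z * (s * N2) ^ s = (Y * s ^ s) * (Z * N2 ^ s) by rewrite expnMn; move: (s ^ s) (N2 ^ s) => *; lia.
    exact: leq_mul.
  by rewrite mulnC leq_mul2l leq_exp2r ?EM ?orbT //; lia.
case: (posnP (Y * Z)) => [-> | YZ0]; first by rewrite muln0.
by apply: leq_trans YZ; rewrite ltn_pmul2r.
Qed.

Lemma sparse_graph r p L : 0 < r -> 0 < p -> r <= 2 ^ L ->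
  exists (F : {set {set 'I_(32 * r * p)}}) t,
    [/\ forall f : {set _}, f \in F -> #|f| = 2,
        forall W : {set _}, #|W| <= 2 * p -> #|spanned F W| <= t,
        r * (32 * r * t) < #|F| & #|F| <= 64 * r ^ 2 * p * (6 + L) + 1].
Proof.
move=> r0 p0 rL.
pose A := 'I_(32 * r * p).
pose E := [set f : {set A} | #|f| == 2].
have cE : #|E| = 'C(32 * r * p, 2) by rewrite card_draws card_ord.
have spanE (W : {set A}) : #|spanned E W| = 'C(#|W|, 2).
  by rewrite -cards_draws; apply: eq_card => f; rewrite !inE andbC.
have E2 : 2 * 'C(2 * p, 2) = 2 * p * (2 * p).-1 by rewrite -mul_bin_diag bin1.
have N2 : 2 * 'C(32 * r * p, 2) = 32 * r * p * (32 * r * p).-1 by rewrite -mul_bin_diag bin1.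
(* For this [t] and [n = 32 * r], [M] is the smallest number of edges that [sparse_arrows]
   accepts. *)
pose t := 2 * p * (6 + L); pose M := r * (32 * r * t) + 1.
have ME : M = 64 * r ^ 2 * p * (6 + L) + 1 by rewrite /M /t; lia.
case: (leqP M 'C(32 * r * p, 2)) => MN; last first.
  (* There are fewer than [M] pairs: the complete graph works, with the trivial bound on spanned
     edges. *)
  exists E, 'C(2 * p, 2); split.
  - by move=> f; rewrite inE => /eqP.
  - by move=> W W2; rewrite spanE leq_bin2l.
  - rewrite cE; move: E2 N2; set a := 'C(2 * p, 2); set b := 'C(_, 2); clearbody a b => E2 N2.
    have : 64 * r ^ 2 * (2 * p * (2 * p).-1) < 2 * (32 * r * p * (32 * r * p).-1).
      have rp : 0 < r * p by rewrite muln_gt0 r0.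
      have -> : 64 * r ^ 2 * (2 * p * (2 * p).-1) = 64 * (r * p) * (2 * (r * (2 * p).-1)) by lia.
      have -> : 2 * (32 * r * p * (32 * r * p).-1) = 64 * (r * p) * (32 * r * p).-1 by lia.
      rewrite ltn_pmul2l ?muln_gt0 ?r0 //.
      have : r * (2 * p).-1 <= r * (2 * p) by rewrite leq_mul2l leq_pred orbT.
      by lia.
    by rewrite -E2 -N2; lia.
  - by rewrite cE -ME ltnW.
pose draws := [set F : {set {set A}} | F \subset E & #|F| == M].
pose bad (W : {set A}) := [set F : {set {set A}} |
   [&& F \subset E, #|F| == M & t.+1 <= #|F :&: spanned E W|]].
have : ~~ (draws \subset \bigcup_(W in [set W : {set A} | #|W| == 2 * p]) bad W).
  apply/negP => /subset_leq_card; apply/negP; rewrite -ltnNge.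
  rewrite cards_draws cE.
  have tM : t.+1 <= M by rewrite /M; nia.
  have Mt : M <= 32 * r ^ 2 * t.+1 by rewrite /M; nia.
  apply: leq_ltn_trans (card_bad_draws_lt r0 p0 rL (ltnSn t) tM Mt MN).
  have <- : #|[set W : {set A} | #|W| == 2 * p]| = 'C(32 * r * p, 2 * p).
    by rewrite card_draws card_ord.
  rewrite -sum_nat_const.
  apply: (@leq_trans (\sum_(W in [set W : {set A} | #|W| == 2 * p]) #|bad W|)).
    exact: card_bigcup_le.
  apply: leq_sum => W; rewrite inE => /eqP W2.
  have sE : spanned E W \subset E by apply/subsetP => f; rewrite inE => /andP[].
  by apply: leq_trans (card_draws_dense sE tM) _; rewrite spanE W2 cE.
case/subsetPn => F; rewrite inE => /andP[FE /eqP FM] good.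
exists F, t; split; rewrite ?FM ?ME //.
- by move=> f /(subsetP FE); rewrite inE => /eqP.
- move=> W W2.
  have pA : 2 * p <= #|A| by rewrite card_ord; nia.
  have [W' WW' cW'] := superset_card W2 pA.
  apply: (@leq_trans #|F :&: spanned E W'|).
    apply: subset_leq_card; apply/subsetP => f; rewrite !inE => /andP[fF fW].
    rewrite fF (subset_trans fW) // andbT.
    by have := subsetP FE f fF; rewrite inE.
  rewrite leqNgt; apply: contra good => bW; apply/bigcupP.
  by exists W'; rewrite inE ?cW' // FE FM eqxx.
- by rewrite -ME /M addn1.
Qed.

(** * Size-Ramsey numbers of paths *)

Lemma ramsey_le k l m r : 0 < l -> 2 * l <= k ->
  ramsey r (path_graph k l m.+1) <= k * (r * m).+1.
Proof.
move=> l0 lk; apply: (proj2 (nat_minP _)).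
exists (complete_kgraph k (('I_(2 * (r * m)).+2 * 'I_l) + ('I_(r * m).+1 * 'I_(k - 2 * l)))%type).
  by apply: complete_arrows => //; lia.
rewrite card_sum !card_prod !card_ord; nia.
Qed.

Lemma size_ramsey_arrows k l m r : 0 < l -> 2 * l <= k ->
  exists2 G : kgraph k, arrows r G (path_graph k l m.+1)
    & #|edges G| = size_ramsey r (path_graph k l m.+1).
Proof.
move=> l0 lk; have kE : k = 2 * l + (k - 2 * l) by lia.
have := complete_arrows (s := r) (m := m) l0 kE.
set G := complete_kgraph _ _ => arrG.
pose P e := exists2 G : kgraph k, arrows r G (path_graph k l m.+1) & #|edges G| = e.
by have [] := @nat_minP P #|edges G| (ex_intro2 _ _ G arrG erefl).
Qed.

Lemma size_ramsey_ge k l m r h (D : nat -> nat) : 0 < l -> 2 * l <= k -> 2 * h < m ->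
    (forall (V : finType) i (E : {set {set V}}), i < r ->
       (forall e : {set V}, e \in E -> #|e| = k) -> (forall v, degree E v < D i) ->
       path_free_coloring E i m) ->
  h * \sum_(i < r) D i <= size_ramsey r (path_graph k l m).
Proof.
case: m => // m l0 lk hm col.
have [G arrG <-] := size_ramsey_arrows m r l0 lk.
rewrite leqNgt; apply/negP => cG; apply: (arrows_no_coloring l0 lk arrG).
apply: (path_free_coloring_few_edges hm _ (subxx (edges G)) cG) => i E ir EG degE.
by apply: col => // e /(subsetP EG); apply: card_edge.
Qed.

(** The degree thresholds grow like [3 * i / k], so [S] is about [3 * r ^ 2 / (2 * k)], three times
    what proper colorings give. *)
Lemma size_ramsey_ge_thirds k l m r : 2 <= k -> 0 < l -> 2 * l <= k -> 0 < r -> 12 * r ^ 2 < m ->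
  exists S, (m.-1)./2 * S <= size_ramsey r (path_graph k l m) /\
    2 * k * r + 3 * r ^ 2 + 6 <= 2 * k * S + 9 * r.
Proof.
move=> k2 l0 lk r0 rm.
(* Degrees below D i keep the intersection degree below 3 (i - 1): i - 1 colors
   for the defective coloring and one for the transversal. *)
pose D i := if i < 2 then 1 else 2 + (3 * i.-1).-1 %/ k.
exists (\sum_(i < r) D i); split.
  apply: size_ramsey_ge => //; first by lia.
  move=> V [|[|i]] E ir Ek; rewrite /D /= => degE.
  - by apply: path_free_coloring_degree0 Ek _ degE _; lia.
  - by apply: path_free_coloring_degree0 Ek _ degE _; lia.
  have kd : k * ((3 * i.+1).-1 %/ k) <= (3 * i.+1).-1 by rewrite mulnC leq_trunc_div.
  (* There are [i + 2 < r] colors here and [k * d <= 3 * i + 2], so [12 * r ^ 2 < m] leaves room for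
     the path bound [3 * (4 * k * d + 1)]. *)
  have r2 : 12 * i.+3 ^ 2 <= 12 * r ^ 2 by rewrite leq_mul2l leq_exp2r // ir.
  apply: (path_free_coloring_thirds Ek degE); first by lia.
  by move: kd; set x := k * _; lia.
case: r r0 {rm} => // r _; elim: r => [|r IHr]; first by rewrite big_ord1 /D /=; lia.
rewrite big_ord_recr /= mulnDr.
suff : 2 * k + 6 * r <= 2 * k * D r.+1 by move: IHr; set S := \sum_(i < _) _; nia.
rewrite /D; case: r {IHr} => [|r] /=; first by lia.
have := divn_eq (3 * r.+1).-1 k; have := ltn_pmod (3 * r.+1).-1 (ltnW k2).
set q := _ %/ k; set x := _ %% k; nia.
Qed.

(** With [i] colors, degrees up to [d + 1] are allowed, where [d] is the largest number with
    [k * d < i]; for [i = 0] no edge may remain. The sum of these thresholds is of order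
    [r ^ 2 / (2 * k)]. *)
Lemma size_ramsey_ge_proper k l m r : 0 < k -> 0 < l -> 2 * l <= k -> 1 < m ->
  exists S, (m.-1)./2 * S <= size_ramsey r (path_graph k l m) /\
    r ^ 2 <= 2 * k * S + r.
Proof.
move=> k0 l0 lk m1.
pose D i := if i is i'.+1 then 2 + i' %/ k else 1.
exists (\sum_(i < r) D i); split.
  apply: size_ramsey_ge => //; first by lia.
  move=> V [|i] E ir Ek; rewrite /D => degE.
    by apply: path_free_coloring_degree0 Ek _ degE _; lia.
  by apply: (path_free_coloring_proper Ek degE) => //; rewrite ltnS mulnC leq_trunc_div.
elim: r => [|r IHr]; first by rewrite big_ord0.
rewrite big_ord_recr /= mulnDr.
suff : r <= k * D r by move: IHr; set S := \sum_(i < _) _; nia.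
rewrite /D; case: r {IHr} => [|r] //.
have := divn_eq r k; have := ltn_pmod r k0.
set q := _ %/ k; set x := _ %% k; nia.
Qed.

Lemma size_ramsey_le k l m r L : 0 < l -> 2 * l <= k -> 0 < m -> 0 < r -> r <= 2 ^ L ->
  size_ramsey r (path_graph k l m) <= 64 * r ^ 2 * m.+1 * (6 + L) + 1.
Proof.
move=> l0 lk m0 r0 rL.
have [F [t [F2 sparse rF Fle]]] := sparse_graph r0 (ltn0Sn m) rL.
have kE : k = 2 * l + (k - 2 * l) by lia.
apply: leq_trans Fle; apply: (@leq_trans #|edges (blow_up kE F2)|); last exact: leq_imset_card.
apply: (proj2 (nat_minP _)); exists (blow_up kE F2) => //.
apply: blow_up_arrows => //; apply: (sparse_arrows F2 sparse _ rF).
by rewrite card_ord.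
Qed.

(** To leading order, [r * N] is at most [(2 / 3) * k * r ^ 2 * m] and [k ^ 2 * E] is at least
    [(3 / 4) * k * r ^ 2 * m]. This gap and [6 * r ^ 2 <= h] absorb the lower order terms. *)
Lemma ramsey_arith k r m s S N E : 2 <= k -> 2 <= r -> 12 * r ^ 2 < m.+1 -> 3 * s <= 2 * r - 2 ->
    N <= k * (s * m).+1 -> m./2 * S <= E ->
    2 * k * r + 3 * r ^ 2 + 6 <= 2 * k * S + 9 * r ->
  r * N <= k ^ 2 * E.
Proof.
move=> k2 r2 rm sr Nle ES rS; set h := m./2 in ES.
have h6 : 6 * r ^ 2 <= h by rewrite /h; lia.
have mh : m <= 2 * h + 1 by rewrite /h; lia.
have q5 : 3 * r ^ 2 + 6 <= 2 * k * S + 5 * r by nia.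
suff key : 6 * (r * (s * m).+1) <= 6 * (k * (h * S)).
  rewrite leq_pmul2l // in key.
  apply: (@leq_trans (r * (k * (s * m).+1))); first by rewrite leq_mul2l Nle orbT.
  rewrite mulnCA expnS expn1 -mulnA leq_mul2l; apply/orP; right.
  by apply: leq_trans key _; rewrite leq_mul2l ES orbT.
have lhs : 6 * (r * (s * m)) <= 2 * (r * ((2 * r - 2) * (2 * h + 1))).
  have : 3 * s * m <= (2 * r - 2) * (2 * h + 1) by apply: leq_mul.
  by move/(leq_mul (leqnn (2 * r))); lia.
have rhs : 3 * h * (3 * r ^ 2 + 6) <= 6 * (k * (h * S)) + 15 * (h * r).
  by have := leq_mul (leqnn (3 * h)) q5; lia.
(* The polynomial [r ^ 2 - 7 * r + 13] has negative discriminant. *)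
have r7 : 7 * r + 5 <= r ^ 2 + 18.
  case: (ltnP r 7) => [r_lt | r_ge]; first by case: r r2 r_lt {rm sr rS q5 h6 lhs rhs} => [|[|[|[|[|[|[|]]]]]]].
  by have := leq_mul r_ge (leqnn r); lia.
have hr7 := leq_mul (leqnn h) r7.
have lhs2 : 6 * (r * (s * m)) + 8 * (h * r) + 4 * r <= 8 * (h * r ^ 2) + 4 * r ^ 2.
  have [r' rE] : exists r', r = r'.+1 by exists r.-1; lia.
  move: lhs; rewrite rE; have -> : 2 * r'.+1 - 2 = 2 * r' by lia.
  lia.
have r_le : r <= r ^ 2 by rewrite -{1}(expn1 r) leq_pexp2l // ltnW.
by move: (k * (h * S)) (r * (s * m)) lhs2 rhs hr7 h6 r_le => X Y; rewrite mulnS; lia.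
Qed.

(* Passage to real numbers *)
From mathcomp Require Import reals exp.
From mathcomp Require Import lra.
Import Order.TTheory GRing.Theory Num.Theory.
Local Open Scope ring_scope.

(** From [ln (1 - x) <= - x] at [x = 1 / 2]. This crude bound lets [ln r] absorb constants. *)
Lemma half_le_ln (R : realType) (r : nat) : (2 <= r)%N -> 1 / 2 <= ln r%:R :> R.
Proof.
move=> r2; have half : ln (2^-1) <= - 2^-1 :> R.
  have := @le_ln1Dx R (- 2^-1); rewrite (_ : 1 + - 2^-1 = 2^-1); last by lra.
  by apply; lra.
have : ln 2 <= ln r%:R :> R by rewrite ler_ln ?posrE ?ler_nat ?ltr0n //; lia.
by move: half; rewrite lnV ?posrE //; lra.
Qed.

Lemma trunc_log2_le_ln (R : realType) (r : nat) : (0 < r)%N ->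
  (trunc_log 2 r)%:R <= 2 * ln r%:R :> R.
Proof.
move=> r0; set T := trunc_log 2 r.
have : ln (2 ^+ T) <= ln r%:R :> R.
  rewrite ler_ln ?posrE ?exprn_gt0 ?ltr0n //.
  by rewrite -natrX ler_nat; apply: trunc_logP.
rewrite lnXn // -(mulr_natl (ln 2)).
have := ler_wpM2l (ler0n R T) (half_le_ln R (leqnn 2)).
lra.
Qed.

Theorem theorem1p7 (R : realType) (k : nat) (hk : (2 <= k)%N) :
  (forall r l m n : nat,
      (2 <= r)%N -> (1 <= l)%N -> (2 * l <= k)%N ->
      (1 <= m)%N -> n = path_order k l m ->
      (12 * r ^ 2 * (k - l) + l < n)%N ->
      r%:R / k%:R ^+ 2 * (ramsey ((2 * r - 2) %/ 3) (path_graph k l m))%:R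
        <= (size_ramsey r (path_graph k l m))%:R :> R)
  /\
  (exists c C : R, [/\ 0 < c, 0 < C &
    exists r0 n0 : nat, forall r l m n : nat,
      (r0 <= r)%N -> (n0 <= n)%N ->
      (1 <= l)%N -> (2 * l <= k)%N ->
      (1 <= m)%N -> n = path_order k l m ->
      c * r%:R ^+ 2 * n%:R <= (size_ramsey r (path_graph k l m))%:R
        <= C * (r%:R ^+ 2 * ln r%:R) * n%:R]).
Proof.
split=> [r l [//|m] n r2 l1 lk _ -> rn | ].
  (* A path with [m + 1] edges has [(m + 1) * (k - l) + l] vertices. *)
  have rm : (12 * r ^ 2 < m.+1)%N.
    have kl : (0 < k - l)%N by lia.
    rewrite -(ltn_pmul2r kl) mulSn; move: rn; rewrite /path_order /=; lia.
  have [S [ES rS]] := size_ramsey_ge_thirds hk l1 lk (ltnW r2) rm.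
  have ramle := ramsey_le m ((2 * r - 2) %/ 3) l1 lk.
  move: ES ramle; set E := size_ramsey _ _; set N := ramsey _ _ => ES ramle.
  have nat_le : (r * N <= k ^ 2 * E)%N by apply: ramsey_arith ramle ES rS; rewrite // mulnC leq_trunc_div.
  have k0 : 0 < k%:R ^+ 2 :> R by rewrite exprn_gt0 // ltr0n; lia.
  by rewrite mulrAC ler_pdivrMr // -natrX -!natrM ler_nat [leqRHS]mulnC.
have kR : 0 < k%:R :> R by rewrite ltr0n; lia.
(* The factor [16 * k ^ 2] comes from [r ^ 2 <= 4 * k * S] and [n <= k * (4 * m./2)]. The upper
   bound is [897 + 128 * T] times [r ^ 2 * n]; as [1] and [T] are at most [2 * ln r], the constant
   is [1794 + 256]. *)
exists ((16 * k%:R ^+ 2)^-1), 2050; split; [by rewrite invr_gt0 mulr_gt0 ?exprn_gt0 | by [] |].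
(* From [3 * k] vertices on, a path has at least three edges, so [m./2] is positive. *)
exists 2%N, (3 * k)%N => r l [//|m] n r2 nk l1 lk _ nE.
have mn : (m.+1 <= n)%N by rewrite nE /path_order /=; nia.
have nm : (n <= k * m.+1)%N by rewrite nE /path_order /=; nia.
have m3 : (3 <= m.+1)%N.
  by rewrite -(leq_pmul2l (ltnW hk)) mulnC (leq_trans nk).
apply/andP; split.
  have [S [ES rS]] := size_ramsey_ge_proper r (ltnW hk) l1 lk (ltnW m3).
  move: ES; set E := size_ramsey _ _ => ES.
  have nat_le : (r ^ 2 * n <= E * (16 * k ^ 2))%N.
    have hm : (m.+1 <= 4 * m./2)%N by lia.
    have rkS : (r ^ 2 <= 4 * k * S)%N by nia.
    have rn : (r ^ 2 * n <= 4 * k * S * (k * (4 * m./2)))%N.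
      by apply: leq_mul => //; apply: leq_trans nm _; rewrite leq_mul2l hm orbT.
    apply: leq_trans rn _.
    have -> : (4 * k * S * (k * (4 * m./2)) = m./2 * S * (16 * k ^ 2))%N by lia.
    by rewrite leq_mul2r ES orbT.
  rewrite -mulrA mulrC ler_pdivrMr ?mulr_gt0 ?exprn_gt0 //.
  by rewrite -!natrX -!natrM ler_nat.
have rL : (r <= 2 ^ (trunc_log 2 r).+1)%N by apply: ltnW; apply: trunc_log_ltn.
have := size_ramsey_le l1 lk (ltn0Sn m) (ltnW r2) rL.
set E := size_ramsey _ _ => Ele.
set T := trunc_log 2 r in Ele *; pose a := (r ^ 2 * n)%N.
have Ea : (E <= 128 * a * (7 + T) + a)%N.
  have r0 : (0 < r ^ 2)%N by rewrite expn_gt0 ltnW.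
  have : (r ^ 2 * m.+2 <= 2 * a)%N by rewrite /a mulnCA leq_mul2l; apply/orP; right; lia.
  have : (0 < a)%N by rewrite muln_gt0 r0; lia.
  by move: Ele; clearbody a; nia.
have aE : a%:R = r%:R ^+ 2 * n%:R :> R by rewrite natrM natrX.
have a0 : 0 <= a%:R :> R by [].
have : E%:R <= 128 * a%:R * (7 + T%:R) + a%:R :> R by rewrite -natrD -!natrM -natrD ler_nat.
move/le_trans; apply.
have -> : 2050 * (r%:R ^+ 2 * ln r%:R) * n%:R = 2050 * (a%:R * ln r%:R) :> R.
  by rewrite aE -!mulrA [ln _ * _]mulrC.
have lnr := ler_wpM2l a0 (half_le_ln R r2).
have Tr := ler_wpM2l a0 (trunc_log2_le_ln R (ltnW r2)).
by lra.
Qed.
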